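(* Let $\Omega\subset\mathbb C^m$ be a bounded domain and let $\mathcal H\subseteq\mathcal O(\Omega)$ be an analytic Hilbert module. Let $\mathcal I\subseteq\mathbb C[z_1,\dots,z_m]$ be an ideal with generators $p_1,\dots,p_t$ and let $\mathcal M=[\mathcal I]$ be the closure of $\mathcal I$ in $\mathcal H$. Let $V(\mathcal I)\subseteq\mathbb C^m$ be the common zero set of $\mathcal I$, and assume that $V(\mathcal M)=V(\mathcal I)\cap\Omega$ is a (complex) submanifold of $\Omega$ of codimension $t$. Then for $w=(w_1,\dots,w_m)\in\Omega$, $$\dim\Big(\bigcap_{j=1}^m\ker (M_{z_j}-w_j)^*\Big)=\begin{cases}1 & \text{if } w\notin V(\mathcal I)\cap\Omega,\\ \text{the codimension of } V(\mathcal I)\cap\Omega \ (=t) & \text{if } w\in V(\mathcal I)\cap\Omega,\end{cases}$$ where $M_{z_j}$ is the operator of multiplication by $z_j$ on $\mathcal M$.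
   Context: A domain is a connected open set; $\mathcal O(\Omega)$ is the ring of holomorphic functions on $\Omega$. An analytic Hilbert module over $\mathbb C[z_1,\dots,z_m]$ is a Hilbert space $\mathcal H\subseteq\mathcal O(\Omega)$ possessing a reproducing kernel (holomorphic in the first variable, anti-holomorphic in the second), such that pointwise multiplication by every polynomial is bounded on $\mathcal H$, and such that $\mathbb C[z_1,\dots,z_m]$ is contained and dense in $\mathcal H$. Adjoints are taken in $\mathcal M$. *)

(* Defs.v *)
From HB Require Import structures.
From mathcomp Require Import all_boot all_order all_algebra.
From mathcomp Require Import sesquilinear complex.
From mathcomp Require Import all_classical all_reals all_analysis.
(* Only the structures are imported: the notations of mpoly clash with those
   of MathComp-Analysis. *)
From mathcomp Require mpoly.
Import (canonicals) mpoly.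

Set Implicit Arguments.
Unset Strict Implicit.
Unset Printing Implicit Defensive.

Import Order.TTheory GRing.Theory Num.Theory.
Import numFieldNormedType.Exports.

Local Open Scope classical_set_scope.
Local Open Scope ring_scope.

(* Packing [R[i]] as a numClosedFieldType (instead of using the bare type)
   gives it the topology and normed-module structure that MathComp-Analysis
   puts on every numClosedFieldType. *)
Definition Cplx (R : realType) : numClosedFieldType := R[i].

Notation Cspace R m := 'rV[Cplx R]_m.
Notation Cpoly R m := (mpoly.mpoly m (Cplx R)).

Section ComplexDomains.
Variables (R : realType) (m : nat).
Implicit Types U V Omega : set (Cspace R m).

Definition domain Omega := open Omega /\ connected Omega.

(* [differentiable] is Frechet differentiability over the scalars [Cplx R],
   that is, complex differentiability. *)
Definition holomorphic (W : normedModType (Cplx R)) U (f : Cspace R m -> W) :=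
  forall z, U z -> differentiable f z.

Definition biholomorphic U (phi : Cspace R m -> Cspace R m) :=
  [/\ open U, open (phi @` U), holomorphic U phi &
      exists psi : Cspace R m -> Cspace R m,
        holomorphic (phi @` U) psi /\ forall z, U z -> psi (phi z) = z].

(* [V] is straightened locally, by a biholomorphic chart of [Omega], to the
   linear subspace where the first [d] coordinates vanish. *)
Definition complex_submanifold Omega V (d : nat) :=
  V `<=` Omega /\
  forall a, V a -> (d <= m)%N /\
    exists U phi, [/\ U a, U `<=` Omega, biholomorphic U phi &
      forall z, U z -> (V z <-> forall j : 'I_m, (j < d)%N -> phi z 0 j = 0)].

End ComplexDomains.

Section Polynomials.
Variables (R : realType) (m : nat).

Definition peval (q : Cpoly R m) (z : Cspace R m) : Cplx R :=
  mpoly.meval (fun j => z 0 j) q.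

Definition poly_var (j : 'I_m) : Cpoly R m := mpoly.mpolyX (Cplx R) (mpoly.mnm1 j).

Definition ideal_gen (t : nat) (p : 'I_t -> Cpoly R m) : set (Cpoly R m) :=
  [set q | exists c : 'I_t -> Cpoly R m, q = \sum_(i < t) c i * p i].

Definition zero_set (I : set (Cpoly R m)) : set (Cspace R m) :=
  [set z | forall q, I q -> peval q z = 0].

End Polynomials.

(* A Hilbert space of functions on [Omega] is an abstract Hilbert space [H]
   with a map [ev] sending a vector to the function it stands for; only the
   values of [ev f] on [Omega] are meaningful. *)
Section FunctionSpaces.
Variables (R : realType) (m : nat) (Omega : set (Cspace R m)).
Variables (H : completeNormedModType (Cplx R)) (dot : {dot H for @Num.conj (Cplx R)}).
Variable ev : H -> Cspace R m -> Cplx R.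

Definition represents (f : H) (F : Cspace R m -> Cplx R) :=
  forall z, Omega z -> ev f z = F z.

(* The set of vectors of [H] whose function is a polynomial in [I]. *)
Definition polys_in (I : set (Cpoly R m)) : set H :=
  [set f | exists2 q, I q & represents f (peval q)].

Definition reproducing_kernel (K : Cspace R m -> Cspace R m -> Cplx R) :=
  [/\ forall w, Omega w ->
        exists2 k, represents k (K^~ w) & forall f, ev f w = dot f k,
      forall w, Omega w -> holomorphic Omega (K^~ w) &
      forall z, Omega z -> holomorphic Omega (fun w => (K z w)^*)].

Record analytic_hilbert_module : Prop := AnalyticHilbertModule {
  ahm_norm : forall f, `|f| ^+ 2 = dot f f;
  ahm_linear : forall (a : Cplx R) f g z, Omega z ->
    ev (a *: f + g) z = a * ev f z + ev g z;
  ahm_inj : forall f g, represents f (ev g) -> f = g;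
  ahm_holomorphic : forall f, holomorphic Omega (ev f);
  ahm_kernel : exists K, reproducing_kernel K;
  ahm_mul : forall q : Cpoly R m, exists c : Cplx R, forall f,
    exists2 g, represents g (fun z => peval q z * ev f z) & `|g| <= c * `|f|;
  ahm_poly : forall q : Cpoly R m, exists f, represents f (peval q);
  ahm_dense : dense (polys_in setT)
}.

(* Multiplication by [q]; the default [0] of [xget] is never used in an
   analytic Hilbert module. *)
Definition mulop (q : Cpoly R m) (f : H) : H :=
  xget 0 [set g | represents g (fun z => peval q z * ev f z)].

(* The adjoint, computed in the closed subspace [M], of an operator [T]
   leaving [M] invariant; by the Riesz theorem the default [0] of [xget] is
   never used when [T] is bounded on [M]. *)
Definition adjoint_in (M : set H) (T : H -> H) (g : H) : H :=
  xget 0 [set h | M h /\ forall f, M f -> dot (T f) g = dot f h].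

Definition joint_kernel (M : set H) (w : Cspace R m) : set H :=
  [set g | M g /\ forall j : 'I_m,
     adjoint_in M (fun f => mulop (poly_var R j) f - w 0 j *: f) g = 0].

End FunctionSpaces.

(* [S] is a linear subspace of dimension [n]. *)
Definition has_dim (K : fieldType) (E : lmodType K) (S : set E) (n : nat) :=
  exists e : 'I_n -> E,
    (forall c : 'I_n -> K, \sum_(i < n) c i *: e i = 0 -> forall i, c i = 0) /\
    S = [set v | exists c : 'I_n -> K, v = \sum_(i < n) c i *: e i].

(* Main.v *)
Require Import Defs.
From HB Require Import structures.
From mathcomp Require Import all_boot all_order all_algebra.
From mathcomp Require Import sesquilinear complex.
From mathcomp Require Import all_classical all_reals all_analysis.
From mathcomp Require mpoly.
Import (canonicals) mpoly.
From mathcomp Require Import ring lra.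
Set Implicit Arguments.
Unset Strict Implicit.
Unset Printing Implicit Defensive.
Import Order.TTheory GRing.Theory Num.Theory.
Import numFieldNormedType.Exports.
Local Open Scope classical_set_scope.
Local Open Scope ring_scope.

(** Write I for the ideal, M for its closure, V for the zero set and K(w) for
    the joint kernel at w.  By the Riesz theorem in M (riesz), the adjoint of
    multiplication by z_j - w_j kills g exactly when g is orthogonal to the
    range of that multiplication, so K(w) is the orthogonal complement in M of
    the product of I with the maximal ideal of w (joint_kernelE).  Modulo that
    product, I is spanned by finitely many polynomials: one element not
    vanishing at w if w is outside V, and p_1, ..., p_t in any case.  Hence
    K(w) has the expected dimension as soon as no member of the spanning
    family lies in the closure of the space N generated by the other members
    and the product: the components of the members orthogonal to these
    closures form a dual basis (orth_dim).

    Outside V this is immediate, because evaluation at w is continuous, kills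
    N and does not kill the chosen element.

    On V the point is that p_1, ..., p_t remains a minimal set of generators
    after completion.  Here N consists of the sums of a_j p_j with
    a_i(w) = 0.  Let D be the derivative at w of a chart straightening V, and
    let l_j, for j = t+1, ..., m, be the j-th coordinate of D(z - w).  The
    m - t linear equations l_j = 0 cut out a plane through w transversal to V,
    meeting V near w only at w (submanifold_slice).  On the set Z defined in
    that plane by the t - 1 equations p_j = 0 for j <> i, the polynomial p_i
    vanishes near w only at w, and a sum of a_j p_j reduces to a_i p_i.  If
    such sums approach p_i in the Hilbert space, they approach it uniformly on
    a small sphere around w (uniform_boundedness), so a_i approaches 1
    uniformly on the intersection of Z with that sphere.  But a_i - 1 has
    modulus 1 at w, and the maximum principle (max_principle_curve) bounds
    this by its values on that intersection.

    The maximum principle holds because Z is given by m - 1 equations in m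
    variables.  Let G be the family of equations and h a polynomial.  At any
    point some nonzero vector v is killed by the derivative of G, and along
    the complex line in direction v the function
    |h|^2 + e |z - w|^2 - C |G|^2 has the positive Levi coefficient
    |h'(v)|^2 + e |v|^2.  So this function has no local maximum, whatever the
    constants e > 0 and C: its maximum over the ball is reached on the sphere.
    Letting e tend to 0 and C to infinity produces a point of Z on the sphere
    where |h| is at least |h(w)|. *)

(** * Complex numbers and real norms *)

Lemma natmul_bounded_le0 (R : realType) (x y : R) :
  (forall n : nat, n%:R * x <= y) -> x <= 0.
Proof.
move=> xy; rewrite leNgt; apply/negP => x0.
have := xy (Num.truncn (y / x)).+1; rewrite -ler_pdivlMr// leNgt => /negP; apply.
exact: truncnS_gt.
Qed.

Section ComplexNumbers.
Variable R : realType.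
Implicit Types (z : Cplx R) (x : R).

Definition cre z : R := complex.Re (z : R[i]).
Definition cim z : R := complex.Im (z : R[i]).
Definition r2c x : Cplx R := Complex x 0.
(** Squared modulus, as an element of R: real-valued functions are needed to
    speak of maxima, since the order on the complex numbers is partial. *)
Definition sqmod z : R := cre z ^+ 2 + cim z ^+ 2.

Lemma cplxP z1 z2 : cre z1 = cre z2 -> cim z1 = cim z2 -> z1 = z2.
Proof. by rewrite /cre /cim; case: z1 z2 => a b [c d] /= -> ->. Qed.

Lemma creD z1 z2 : cre (z1 + z2) = cre z1 + cre z2.
Proof. by case: z1 z2 => a b [c d]. Qed.
Lemma cimD z1 z2 : cim (z1 + z2) = cim z1 + cim z2.
Proof. by case: z1 z2 => a b [c d]. Qed.
Lemma creN z : cre (- z) = - cre z.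
Proof. by case: z. Qed.
Lemma cimN z : cim (- z) = - cim z.
Proof. by case: z. Qed.
Lemma creB z1 z2 : cre (z1 - z2) = cre z1 - cre z2.
Proof. by rewrite creD creN. Qed.
Lemma cimB z1 z2 : cim (z1 - z2) = cim z1 - cim z2.
Proof. by rewrite cimD cimN. Qed.
Lemma creM z1 z2 : cre (z1 * z2) = cre z1 * cre z2 - cim z1 * cim z2.
Proof. by case: z1 z2 => a b [c d]. Qed.
Lemma cimM z1 z2 : cim (z1 * z2) = cre z1 * cim z2 + cim z1 * cre z2.
Proof. by case: z1 z2 => a b [c d]. Qed.

Lemma r2cD : {morph r2c : x y / x + y}.
Proof. by move=> x y; apply: cplxP; rewrite ?creD ?cimD /cre /cim /= ?addr0. Qed.
Lemma r2cM : {morph r2c : x y / x * y}.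
Proof.
move=> x y; apply: cplxP; rewrite ?creM ?cimM /cre /cim /=.
  by rewrite mulr0 subr0.
by rewrite mulr0 mul0r addr0.
Qed.
Lemma cre_r2cM x z : cre (r2c x * z) = x * cre z.
Proof. by rewrite creM /cre /cim /= mul0r subr0. Qed.
Lemma r2c_le x y : (r2c x <= r2c y) = (x <= y).
Proof. exact: lecR. Qed.
Lemma r2c_lt x y : (r2c x < r2c y) = (x < y).
Proof. exact: ltcR. Qed.
Lemma r2cX x n : r2c (x ^+ n) = r2c x ^+ n.
Proof. by elim: n => [|n IH]; rewrite ?expr0// !exprS r2cM IH. Qed.

Lemma r2c_ge0 z : 0 <= z -> z = r2c (cre z).
Proof.
by move=> z0; apply: cplxP => //; move: z0; rewrite lecE => /andP[/eqP h _]; exact: h.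
Qed.

Lemma r2c_gt0 z : 0 < z -> z = r2c (cre z) /\ 0 < cre z.
Proof.
move=> z0; have e := r2c_ge0 (ltW z0); split => //.
by rewrite -r2c_lt -e.
Qed.

Lemma norm_r2c (V : normedZmodType (Cplx R)) (v : V) : `|v| = r2c (cre `|v|).
Proof. exact: r2c_ge0. Qed.

Lemma cre_norm_ge0 (V : normedZmodType (Cplx R)) (v : V) : 0 <= cre `|v|.
Proof. by rewrite -r2c_le -norm_r2c; exact: normr_ge0. Qed.

Lemma sqmodE z : r2c (sqmod z) = `|z| ^+ 2.
Proof. exact: add_Re2_Im2. Qed.

Lemma sqmod_ge0 z : 0 <= sqmod z.
Proof. by rewrite addr_ge0 ?sqr_ge0. Qed.

Lemma sqmodD_le z1 z2 : sqmod (z1 + z2) <= 2 * sqmod z1 + 2 * sqmod z2.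
Proof.
rewrite /sqmod creD cimD.
have := sqr_ge0 (cre z1 - cre z2); have := sqr_ge0 (cim z1 - cim z2).
by move: (cre z1) (cre z2) (cim z1) (cim z2) => a b c d; lra.
Qed.

Lemma sqmod0 : sqmod 0 = 0.
Proof. by rewrite /sqmod /cre /cim /= expr0n addr0. Qed.

Lemma sqmod_eq0 z : (sqmod z == 0) = (z == 0).
Proof.
apply/eqP/eqP => [h|->]; last exact: sqmod0.
have := sqmodE z; rewrite h => /esym /eqP.
by rewrite -[r2c 0]/(0 : Cplx R) expf_eq0 /= normr_eq0 => /eqP.
Qed.

Lemma sqmod_le z1 z2 : (sqmod z1 <= sqmod z2) = (`|z1| <= `|z2|).
Proof. by rewrite -r2c_le !sqmodE ler_pXn2r// nnegrE. Qed.

Lemma cre_le z : `|cre z| <= cre `|z|.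
Proof. by rewrite -r2c_le -norm_r2c; exact: normc_ge_Re. Qed.

Lemma cim_le z : `|cim z| <= cre `|z|.
Proof.
rewrite -ler_sqr ?nnegrE ?normr_ge0 ?cre_norm_ge0//.
rewrite -r2c_le (r2cX (cre _)) -norm_r2c -sqmodE r2c_le real_normK ?num_real//.
by rewrite lerDr sqr_ge0.
Qed.

Lemma norm_le_reim z : `|z| <= r2c (`|cre z| + `|cim z|).
Proof.
have -> : z = r2c (cre z) + Complex 0 (cim z).
  by apply: cplxP; rewrite ?creD ?cimD /cre /cim /= ?addr0 ?add0r.
apply: le_trans (ler_normD _ _) _; rewrite r2cD.
rewrite creD cimD /cre /cim /= addr0 add0r.
rewrite !normc_def /= expr0n /= addr0 add0r !sqrtr_sqr; exact: lexx.
Qed.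

Lemma nbhs_cplxP z (A : set (Cplx R)) : nbhs z A <->
  exists2 e : R, 0 < e & forall y, `|y - z| < r2c e -> A y.
Proof.
split.
  move=> /nbhs_ballP[e /= e0 eA]; have [ee re0] := r2c_gt0 e0.
  exists (cre e) => // y; rewrite -ee => yz; apply: eA.
  by rewrite -ball_normE /= distrC.
move=> [e e0 eA]; apply/nbhs_ballP; exists (r2c e) => /=.
  by rewrite (r2c_lt 0).
by move=> y; rewrite -ball_normE /= distrC; exact: eA.
Qed.

Lemma cre_continuous : continuous cre.
Proof.
move=> z A /nbhs_ballP[e /= e0 eA]; apply/nbhs_cplxP; exists e => // y yz.
apply: eA; rewrite -ball_normE /= distrC -creB.
by apply: le_lt_trans (cre_le _) _; rewrite -r2c_lt -norm_r2c.
Qed.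

Lemma cim_continuous : continuous cim.
Proof.
move=> z A /nbhs_ballP[e /= e0 eA]; apply/nbhs_cplxP; exists e => // y yz.
apply: eA; rewrite -ball_normE /= distrC -cimB.
by apply: le_lt_trans (cim_le _) _; rewrite -r2c_lt -norm_r2c.
Qed.

Lemma sqmod_continuous : continuous sqmod.
Proof.
move=> z.
apply: (@continuousD R R^o (Cplx R) (fun z => cre z ^+ 2) (fun z => cim z ^+ 2)).
  apply: (@continuous_comp _ _ _ cre (fun x => x ^+ 2)).
    exact: cre_continuous.
  exact: exprn_continuous.
apply: (@continuous_comp _ _ _ cim (fun x => x ^+ 2)).
  exact: cim_continuous.
exact: exprn_continuous.
Qed.

Lemma compact_square (x : R) :
  compact [set z : Cplx R | `|cre z| <= x /\ `|cim z| <= x].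
Proof.
pose f (u : R * R) : Cplx R := Complex u.1 u.2.
have fc : continuous f.
  move=> u A /nbhs_cplxP[e e0 eA].
  apply/nbhs_ballP; exists (e / 2); rewrite /= ?divr_gt0// => v [].
  rewrite -!ball_normE /= => h1 h2; apply: eA.
  apply: le_lt_trans (norm_le_reim _) _; rewrite r2c_lt creB cimB /cre /cim /=.
  by rewrite [e]splitr ltrD// distrC.
rewrite (_ : [set _ | _] = f @` (`[-x, x] `*` `[-x, x])); last first.
  apply/seteqP; split => [z [h1 h2]|_ [u [/= h1 h2]] <-].
    exists (cre z, cim z); last by apply: cplxP.
    by split => /=; rewrite in_itv /= -ler_norml.
  by move: h1 h2; rewrite !in_itv /= -!ler_norml.
apply: continuous_compact; first exact: continuous_subspaceT.
by apply: compact_setX; exact: segment_compact.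
Qed.

Lemma norm_rV_coord m (v : Cspace R m) j : `|v 0 j| <= `|v|.
Proof.
rewrite [leRHS]/Num.Def.normr /= mx_normE -[leLHS]nngE num_le.
exact: (@le_bigmax _ _ _ _ (fun x : 'I_1 * 'I_m => `|v x.1 x.2|%:nng) (0, j)).
Qed.

Lemma norm_rV_le m (v : Cspace R m) (c : Cplx R) : 0 <= c ->
  (forall j, `|v 0 j| <= c) -> `|v| <= c.
Proof.
move=> /nonnegP[{}c] h; rewrite /Num.Def.normr /= mx_normE num_le.
apply/bigmax_leP; split => [|[i j] _]; rewrite -num_le /=.
  exact: ge0.
by rewrite ord1; exact: h.
Qed.

Lemma cnormB_continuous (V : normedModType (Cplx R)) (w : V) :
  continuous (fun v : V => cre `|v - w|).
Proof.
move=> v; pose f (v : V) := v - w; pose g (v : V) : Cplx R := `|v|.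
have fc : {for v, continuous f}.
  apply: (@continuousB (Cplx R) V V id (fun=> w)) => //.
  exact: cst_continuous.
have gc : {for f v, continuous g} by exact: norm_continuous.
exact: (continuous_comp (continuous_comp fc gc) (@cre_continuous _)).
Qed.

Lemma closed_cball (V : normedModType (Cplx R)) (w : V) (r : R) :
  closed [set z : V | `|z - w| <= r2c r].
Proof.
rewrite (_ : [set _ | _] = (fun z : V => cre `|z - w|) @^-1` [set x | x <= r]).
  apply: preimage_closed; last exact: closed_le.
  by move=> z _; exact: cnormB_continuous.
by apply/seteqP; split => z /=; rewrite -r2c_le -norm_r2c.
Qed.

(** Compactness is transported from squares in the plane, which are images of
    squares of R * R, through Tychonoff's theorem for row vectors. *)
Lemma compact_cball m (w : Cspace R m) (r : R) :
  compact [set z | `|z - w| <= r2c r].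
Proof.
pose x := r + cre `|w|.
have /= cK := @rV_compact (Cplx R) m (fun=> _) (fun=> @compact_square x).
apply: subclosed_compact cK _; first exact: closed_cball.
move=> z /= zr i.
have : `|z ord0 i| <= r2c x.
  apply: le_trans (norm_rV_coord _ _) _.
  by rewrite -[z](subrK w) r2cD -norm_r2c (le_trans (ler_normD _ _))// lerD2r.
rewrite norm_r2c r2c_le => h; split; apply: le_trans h.
  exact: cre_le.
exact: cim_le.
Qed.

End ComplexNumbers.

(** * Levi coefficients of functions on the complex line *)

Section Levi.
Variable R : realType.
Implicit Types (phi : Cplx R -> R) (P Q : {poly Cplx R}).

Definition ci : Cplx R := Complex 0 1.

(** A function that expands as phi(0) + Re(a z + b z^2) + A |z|^2 + O(|z|^3)
    has, over the four points s, is, -s, -is, the sum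
    4 phi(0) + 4 A s^2 + O(s^3): this sum filters out the harmonic part.
    Defining A by the sum makes it additive in phi at once. *)
Definition levi_coef phi (A : R) := exists C : R, forall s : R, 0 <= s <= 1 ->
  `|phi (r2c s) + phi (r2c s * ci) + phi (- r2c s) + phi (- (r2c s * ci))
    - 4 * phi 0 - 4 * A * s ^+ 2| <= C * s ^+ 3.

Lemma levi_add phi psi A B : levi_coef phi A -> levi_coef psi B ->
  levi_coef (fun z => phi z + psi z) (A + B).
Proof.
move=> [C hC] [D hD]; exists (C + D) => s s01.
rewrite [leRHS]mulrDl (le_trans _ (lerD (hC s s01) (hD s s01)))//.
apply: le_trans (ler_normD _ _); rewrite le_eqVlt; apply/orP; left.
apply/eqP; congr (`|_|); ring.
Qed.

Lemma levi_scale phi A (c : R) : levi_coef phi A -> levi_coef (fun z => c * phi z) (c * A).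
Proof.
move=> [C hC]; exists (`|c| * C) => s s01.
rewrite -[leRHS]mulrA (le_trans _ (ler_wpM2l (normr_ge0 c) (hC s s01)))// -normrM.
rewrite le_eqVlt; apply/orP; left; apply/eqP; congr (`|_|); ring.
Qed.

Lemma levi_cst (c : R) : levi_coef (fun=> c) 0.
Proof.
by exists 0 => s _; rewrite mulr0 mul0r subr0 mul0r normr_le0; apply/eqP; ring.
Qed.

Lemma levi_sum (I : Type) (r : seq I) (P : pred I) (phi : I -> Cplx R -> R)
    (A : I -> R) : (forall i, P i -> levi_coef (phi i) (A i)) ->
  levi_coef (fun z => \sum_(i <- r | P i) phi i z) (\sum_(i <- r | P i) A i).
Proof.
move=> h; elim: r => [|i r IH].
  under eq_fun do rewrite big_nil.
  by rewrite big_nil; exact: levi_cst.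
under eq_fun do rewrite big_cons.
rewrite big_cons; case: ifP => // Pi; apply: levi_add => //; exact: h.
Qed.

(** Averaging over the four points gives A s^2 <= O(s^3) at a local
    maximum. *)
Lemma levi_coef_max phi A (d : R) : 0 < d ->
  (forall z, `|z| < r2c d -> phi z <= phi 0) -> levi_coef phi A -> A <= 0.
Proof.
move=> d0 dmax [C hC]; rewrite leNgt; apply/negP => A0.
pose s := Num.min 1 (Num.min (d / 2) (A / (`|C| + 1))).
have C1 : 0 < `|C| + 1 by rewrite ltr_wpDl.
have s0 : 0 < s by rewrite !lt_min ltr01 !divr_gt0.
have sd : s < d.
  rewrite /s !gt_min; apply/orP; right; apply/orP; left.
  by rewrite ltr_pdivrMr// ltr_pMr// ltr1n.
have s1 : s <= 1 by rewrite ge_min lexx.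
have sA : s * (`|C| + 1) <= A by rewrite -ler_pdivlMr// !ge_min lexx !orbT.
have nrc : `|r2c s| < r2c d.
  by rewrite norm_r2c r2c_lt normc_def /cre /= expr0n addr0 sqrtr_sqr gtr0_norm.
have nci : `|r2c s * ci| < r2c d.
  by rewrite normrM (_ : `|ci| = 1) ?mulr1// normc_def /= expr0n expr1n add0r sqrtr1.
have h1 := dmax _ nrc; have h2 := dmax _ nci.
have h3 := dmax (- r2c s); have h4 := dmax (- (r2c s * ci)).
rewrite normrN in h3; rewrite normrN in h4.
have {}h3 := h3 nrc; have {}h4 := h4 nci.
have := hC s; rewrite (ltW s0) s1 => /(_ isT).
rewrite ler_norml => /andP[+ _].
set X := phi (r2c s) + _ + _ + _ => h.
have hX : X <= 4 * phi 0 by rewrite /X; lra.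
have h5 : 4 * A * s ^+ 2 <= C * s ^+ 3 by lra.
have h6 : 4 * A <= C * s by rewrite -(ler_pM2r (exprn_gt0 2 s0)) -[leRHS]mulrA -exprS.
have h7 : C * s <= `|C| * s by rewrite ler_pM2r// ler_norm.
have : 4 * A <= A by nra.
by lra.
Qed.

Lemma poly_bound Q : exists2 B : R, 0 <= B &
  forall z : Cplx R, `|z| <= 1 -> `|Q.[z]| <= r2c B.
Proof.
exists (\sum_(i < size Q) cre `|Q`_i|).
  by apply: sumr_ge0 => i _; exact: cre_norm_ge0.
move=> z z1; rewrite horner_coef.
apply: le_trans (ler_norm_sum _ _ _) _.
rewrite (big_morph _ (@r2cD R) (erefl : r2c 0 = 0)); apply: ler_sum => i _.
rewrite -norm_r2c normrM ler_piMr// normrX exprn_ile1//.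
Qed.

(** Over the four points the monomials 1, z, z^2 are orthogonal, so the
    truncation of P at degree 2 contributes exactly the sum of
    |P_k|^2 s^(2k); the remainder is O(s^3). *)
Lemma levi_sqmod_poly P : levi_coef (fun z => sqmod P.[z]) (sqmod P`_1).
Proof.
pose Q := drop_poly 3 P.
have PE z : P.[z] = P`_0 + P`_1 * z + P`_2 * z ^+ 2 + Q.[z] * z ^+ 3.
  rewrite -{1}(poly_take_drop 3 P) hornerD hornerM hornerXn; congr (_ + _).
  by rewrite horner_poly !big_ord_recr big_ord0 /= add0r expr0 expr1 mulr1.
have [B B0 hB] := poly_bound Q.
pose T : R := cre (`|P`_0| + `|P`_1| + `|P`_2|).
have T0 : 0 <= T by rewrite -r2c_le -r2c_ge0 ?addr_ge0.
pose t z := P`_0 + P`_1 * z + P`_2 * z ^+ 2.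
pose C1 := 4 * T * B + 2 * B ^+ 2.
have tB z : `|z| <= 1 -> `|t z| <= r2c T.
  move=> z1; rewrite -r2c_ge0 ?addr_ge0//.
  rewrite /t (le_trans (ler_normD _ _))// lerD//.
    by rewrite (le_trans (ler_normD _ _))// lerD// normrM ler_piMr.
  by rewrite normrM ler_piMr// normrX exprn_ile1.
have key s z : 0 <= s <= 1 -> `|z| = r2c s -> 
    `|sqmod P.[z] - sqmod (t z)| <= C1 * s ^+ 3.
  move=> /andP[s0 s1] zs.
  have z1 : `|z| <= 1 by rewrite zs (r2c_le _ 1).
  pose e := Q.[z] * z ^+ 3.
  have eB : `|e| <= r2c (B * s ^+ 3).
    by rewrite normrM normrX zs r2cM r2cX ler_wpM2r ?hB// exprn_ge0// (r2c_le 0).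
  have [h1 h2] : `|cre e| <= B * s ^+ 3 /\ `|cim e| <= B * s ^+ 3.
    by move: eB; rewrite norm_r2c r2c_le => h; split; 
      [exact: le_trans (cre_le _) h|exact: le_trans (cim_le _) h].
  have [h3 h4] : `|cre (t z)| <= T /\ `|cim (t z)| <= T.
    by have := tB z z1; rewrite norm_r2c r2c_le => h; split; 
      [exact: le_trans (cre_le _) h|exact: le_trans (cim_le _) h].
  have -> : sqmod P.[z] - sqmod (t z) =
     2 * (cre (t z) * cre e) + 2 * (cim (t z) * cim e) + cre e ^+ 2 + cim e ^+ 2.
    by rewrite PE -/(t z) -/e /sqmod creD cimD; ring.
  have s3 : 0 <= s ^+ 3 by rewrite exprn_ge0.
  have s31 : s ^+ 3 <= 1 by rewrite exprn_ile1.
  have Bs : B * s ^+ 3 <= B by rewrite ler_piMr.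
  have Bs0 : 0 <= B * s ^+ 3 by rewrite mulr_ge0.
  have a1 : `|cre (t z) * cre e| <= T * (B * s ^+ 3) by rewrite normrM ler_pM.
  have a2 : `|cim (t z) * cim e| <= T * (B * s ^+ 3) by rewrite normrM ler_pM.
  have a3 : cre e ^+ 2 <= B * (B * s ^+ 3).
    by rewrite -real_normK ?num_real// expr2 ler_pM// (le_trans h1).
  have a4 : cim e ^+ 2 <= B * (B * s ^+ 3).
    by rewrite -real_normK ?num_real// expr2 ler_pM// (le_trans h2).
  have b3 := sqr_ge0 (cre e); have b4 := sqr_ge0 (cim e).
  move: a1 a2; rewrite !ler_norml => /andP[? ?] /andP[? ?].
  rewrite /C1; apply/andP; split; nra.
exists (4 * C1 + 4 * sqmod P`_2) => s s01.
have nrc : `|r2c s| = r2c s by rewrite ger0_norm// (r2c_le 0); case/andP: s01.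
have nci : `|r2c s * ci| = r2c s.
  by rewrite normrM nrc (_ : `|ci| = 1) ?mulr1// normc_def /= expr0n expr1n add0r sqrtr1.
have k1 := key _ _ s01 nrc; have k2 := key _ _ s01 nci.
have k3 := key s (- r2c s) s01; rewrite normrN in k3; have {}k3 := k3 nrc.
have k4 := key s (- (r2c s * ci)) s01; rewrite normrN in k4; have {}k4 := k4 nci.
have avg : sqmod (t (r2c s)) + sqmod (t (r2c s * ci)) + sqmod (t (- r2c s)) +
   sqmod (t (- (r2c s * ci))) = 4 * sqmod P`_0 + 4 * sqmod P`_1 * s ^+ 2 
   + 4 * sqmod P`_2 * s ^+ 4.
  rewrite /t !expr2 /sqmod !(creD, cimD, creM, cimM, creN, cimN).
  rewrite /cre /cim /=; ring.
have P0 : sqmod P.[0] = sqmod P`_0 by rewrite horner_coef0.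
have s34 : s ^+ 4 <= s ^+ 3.
  by rewrite exprS ler_piMl ?exprn_ge0//; case/andP: s01.
have s40 : 0 <= s ^+ 4 by rewrite exprn_ge0//; case/andP: s01.
have n2 := sqmod_ge0 P`_2.
rewrite P0; move: k1 k2 k3 k4; rewrite !ler_norml.
move=> /andP[? ?] /andP[? ?] /andP[? ?] /andP[? ?].
have m1 : sqmod P`_2 * s ^+ 4 <= sqmod P`_2 * s ^+ 3 by rewrite ler_wpM2l.
have m2 : 0 <= sqmod P`_2 * s ^+ 4 by rewrite mulr_ge0.
apply/andP; split; lra.
Qed.

End Levi.

(** * Restriction of polynomials to complex lines *)

Section Lines.
Variables (R : realType) (m : nat).
Implicit Types (q : Cpoly R m) (b v z : Cspace R m).

Lemma Cpoly_ind (P : Cpoly R m -> Prop) :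
  (forall c, P (mpoly.mpolyC m c)) -> (forall j, P (poly_var R j)) ->
  (forall p q, P p -> P q -> P (p + q)) ->
  (forall p q, P p -> P q -> P (p * q)) -> forall q, P q.
Proof.
move=> hC hX hD hM; apply: mpoly.mpolyind => [|c k p _ _ hp].
  by rewrite -(mpoly.mpolyC0 m); exact: hC.
apply: (hD _ _) => //; rewrite -mpoly.mul_mpolyC; apply: (hM _ _); first exact: hC.
have h1 : P 1 by rewrite -mpoly.mpolyC1; exact: hC.
rewrite mpoly.mpolyXE_id; apply: (big_ind P) => [//|x y hx hy|i _]; first exact: hM.
elim: (mpoly.fun_of_multinom k i) => [|n IH]; first by rewrite expr0.
by rewrite exprS; apply: (hM _ _) => //; exact: hX.
Qed.

Lemma pevalC c z : peval (mpoly.mpolyC m c) z = c.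
Proof. exact: mpoly.mevalC. Qed.
Lemma peval_var j z : peval (poly_var R j) z = z 0 j.
Proof. exact: mpoly.mevalXU. Qed.
Lemma pevalD p q z : peval (p + q) z = peval p z + peval q z.
Proof. exact: mpoly.mevalD. Qed.
Lemma pevalB p q z : peval (p - q) z = peval p z - peval q z.
Proof. exact: mpoly.mevalB. Qed.
Lemma pevalM p q z : peval (p * q) z = peval p z * peval q z.
Proof. exact: mpoly.mevalM. Qed.
Lemma peval0 z : peval (0 : Cpoly R m) z = 0.
Proof. exact: mpoly.meval0. Qed.
Lemma peval1 z : peval (1 : Cpoly R m) z = 1.
Proof. exact: mpoly.meval1. Qed.
Lemma peval_sum I (r : seq I) (P : pred I) (F : I -> Cpoly R m) z :
  peval (\sum_(i <- r | P i) F i) z = \sum_(i <- r | P i) peval (F i) z.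
Proof. by rewrite (big_morph (fun q => peval q z) (fun p q => pevalD p q z) (peval0 z)). Qed.

Lemma peval_continuous q : continuous (peval q).
Proof.
elim/Cpoly_ind: q => [c|j|p q hp hq|p q hp hq] z.
- rewrite (_ : peval _ = fun=> c); first exact: cst_continuous.
  by apply/funext => ?; rewrite pevalC.
- rewrite (_ : peval _ = fun z => z 0 j); first exact: coord_continuous.
  by apply/funext => ?; rewrite peval_var.
- rewrite (_ : peval _ = fun z => peval p z + peval q z).
    by apply: continuousD; [exact: hp|exact: hq].
  by apply/funext => ?; rewrite pevalD.
- rewrite (_ : peval _ = fun z => peval p z * peval q z).
    by apply: continuousM; [exact: hp|exact: hq].
  by apply/funext => ?; rewrite pevalM.
Qed.

Definition on_line q b v : {poly Cplx R} :=
  mpoly.mmap (@polyC (Cplx R)) (fun j => (b 0 j)%:P + (v 0 j)%:P * 'X) q.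

Lemma horner_on_line q b v l : (on_line q b v).[l] = peval q (b + l *: v).
Proof.
rewrite /on_line; elim/Cpoly_ind: q => [c|j|p q hp hq|p q hp hq].
- by rewrite mpoly.mmapC hornerC pevalC.
- rewrite peval_var mpoly.mmapX mpoly.mmap1U !mxE hornerD hornerM hornerX !hornerC.
  by rewrite mulrC.
- by rewrite mpoly.mmapD hornerD hp hq pevalD.
- by rewrite rmorphM hornerM hp hq pevalM.
Qed.

(** Linearity in v is what makes fewer than m equations have a common nonzero
    tangent direction. *)
Lemma on_line_deriv q b : exists d : 'I_m -> Cplx R,
  forall v, (on_line q b v)`_1 = \sum_j d j * v 0 j.
Proof.
rewrite /on_line; elim/Cpoly_ind: q => [c|j|p q [d hd] [e he]|p q [d hd] [e he]].
- exists (fun=> 0) => v; rewrite mpoly.mmapC coefC big1// => i _.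
  by rewrite mul0r.
- exists (fun i => (i == j)%:R) => v.
  rewrite mpoly.mmapX mpoly.mmap1U coefD coefC /= add0r coefCM coefX mulr1.
  rewrite (bigD1 j)//= eqxx mul1r big1 ?addr0// => i /negbTE ->.
  by rewrite mul0r.
- exists (fun i => d i + e i) => v; rewrite mpoly.mmapD coefD hd he -big_split.
  by apply: eq_bigr => i _; rewrite mulrDl.
- exists (fun i => peval p b * e i + peval q b * d i) => v.
  have E r : (on_line r b v)`_0 = peval r b.
    by rewrite -horner_coef0 horner_on_line scale0r addr0.
  rewrite rmorphM coefM !big_ord_recr big_ord0 /= add0r -!/(on_line _ _ _) !E.
  transitivity (peval p b * (\sum_j e j * v 0 j) +
                (\sum_j d j * v 0 j) * peval q b); first by rewrite -he -hd.
  rewrite mulr_sumr mulr_suml -big_split /=.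
  by apply: eq_bigr => i _; ring.
Qed.

End Lines.

(** * A maximum principle for m - 1 equations in m variables *)

Section MaximumPrinciple.
Variables (R : realType) (m : nat).
Variables (G : 'I_m -> Cpoly R m) (i0 : 'I_m) (h : Cpoly R m).
Variables (w : Cspace R m) (r : R).
Hypotheses (r0 : 0 < r) (Gw : forall j, j != i0 -> peval (G j) w = 0).

Let Phi (n : nat) (z : Cspace R m) : R :=
  sqmod (peval h z) + n.+1%:R^-1 * \sum_j sqmod (z 0 j - w 0 j)
  + - n%:R * \sum_(j | j != i0) sqmod (peval (G j) z).

Let Phi_continuous n : continuous (Phi n).
Proof.
have hq (q : Cpoly R m) : continuous (fun z => sqmod (peval q z)).
  move=> z; apply: continuous_comp; first exact: peval_continuous.
  exact: sqmod_continuous.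
have hw j : continuous (fun z : Cspace R m => sqmod (z 0 j - w 0 j)).
  rewrite (_ : (fun _ => _) = fun z => 
    sqmod (peval (poly_var R j - mpoly.mpolyC m (w 0 j)) z)); first exact: hq.
  by apply/funext => z; rewrite pevalB peval_var pevalC.
have hs (P : pred 'I_m) (F : 'I_m -> Cspace R m -> R) :
    (forall j, continuous (F j)) -> continuous (fun z => \sum_(j | P j) F j z).
  by move=> hF; apply: continuous_big => //; exact: add_continuous.
have hA (f g : Cspace R m -> R) : continuous f -> continuous g ->
    continuous (fun z => f z + g z).
  by move=> hf hg z; exact: (@continuousD R R^o _ f g z (hf z) (hg z)).
have hZ c (f : Cspace R m -> R) : continuous f -> continuous (fun z => c * f z).
  by move=> hf z; exact: (@continuousM R _ (fun=> c) f z (@cst_continuous _ _ _ _) (hf z)).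
apply: (hA _ _); first by apply: (hA _ _); [exact: hq|apply/hZ/hs].
by apply/hZ/hs => j; exact: hq.
Qed.

(** There are m - 1 equations, so a nonzero direction v is killed by all their
    derivatives at b; along it the subtracted term has Levi coefficient 0 and
    the middle term a positive one. *)
Let no_local_max n b (e : R) : 0 < e ->
  ~ (forall z, `|z - b| < r2c e -> Phi n z <= Phi n b).
Proof.
move=> e0 bmax.
have [d dE] := choice (fun j => on_line_deriv (G j) b).
(* The zero column i0 makes the square matrix of derivatives singular. *)
pose A : 'M[Cplx R]_m := \matrix_(k, j) (if j == i0 then 0 else d j k).
have /eqP /det0P [v v0 vA] : \det A = 0.
  rewrite (expand_det_col _ i0) big1// => k _.
  by rewrite mxE eqxx mul0r.
have vG j : j != i0 -> (on_line (G j) b v)`_1 = 0.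
  move=> ji; rewrite dE; have /rowP/(_ j) := vA; rewrite !mxE => vAj.
  rewrite -[RHS]vAj.
  by apply: eq_bigr => k _; rewrite !mxE (negbTE ji) mulrC.
have [k vk] : exists k, v 0 k != 0.
  by apply/existsP; apply: contraNT v0; rewrite negb_exists => /forallP h0;
    apply/eqP/rowP => k; have := h0 k; rewrite negbK mxE => /eqP.
pose L (j : 'I_m) := (b 0 j - w 0 j)%:P + (v 0 j)%:P * 'X.
have LE j l : (L j).[l] = (b + l *: v) 0 j - w 0 j.
  rewrite !mxE hornerD hornerM hornerX !hornerC mulrC; ring.
have L1 j : (L j)`_1 = v 0 j.
  by rewrite coefD coefC /= add0r coefCM coefX mulr1.
have lev : levi_coef (fun l => Phi n (b + l *: v)) 
   (sqmod (on_line h b v)`_1 + n.+1%:R^-1 * \sum_j sqmod (v 0 j)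
    + - n%:R * \sum_(j | j != i0) 0).
  rewrite (_ : (fun _ => _) = fun l => sqmod (on_line h b v).[l] +
    n.+1%:R^-1 * (\sum_j sqmod (L j).[l]) + 
    - n%:R * (\sum_(j | j != i0) sqmod (on_line (G j) b v).[l])); last first.
    apply/funext => l; rewrite /Phi horner_on_line.
    congr (_ + _ * _ + _ * _); apply: eq_bigr => j _; rewrite ?LE//.
    by rewrite horner_on_line.
  apply: levi_add; first apply: levi_add; first exact: levi_sqmod_poly.
    by apply/levi_scale/levi_sum => j _; rewrite -L1; exact: levi_sqmod_poly.
  apply/levi_scale/levi_sum => j ji.
  by have := levi_sqmod_poly (on_line (G j) b v); rewrite vG// sqmod0.
have v1 : `|v| + 1 > 0 by rewrite ltr_wpDl.
have [v1E v1gt] := r2c_gt0 v1.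
have : sqmod (on_line h b v)`_1 + n.+1%:R^-1 * (\sum_j sqmod (v 0 j)) +
    - n%:R * (\sum_(j | j != i0) 0) <= 0.
  apply: (levi_coef_max (d := e / cre (`|v| + 1)) _ _ lev); first by rewrite divr_gt0.
  move=> l ln; rewrite scale0r addr0; apply: bmax.
  rewrite addrC addKr normrZ.
  apply: (@le_lt_trans _ _ (`|l| * (`|v| + 1))).
    by rewrite ler_wpM2l// lerDl.
  have -> : r2c e = r2c (e / cre (`|v| + 1)) * (`|v| + 1).
    by rewrite {2}v1E -r2cM divfK// gt_eqF.
  by rewrite ltr_pM2r.
apply/negP; rewrite -ltNge (big1 _ (fun j => j != i0))// mulr0 addr0.
apply: ltr_wpDl; first exact: sqmod_ge0.
rewrite mulr_gt0 ?invr_gt0// (bigD1 k)//= ltr_pwDl//.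
  by rewrite lt_neqAle sqmod_ge0 eq_sym sqmod_eq0 vk.
by apply: sumr_ge0 => j _; exact: sqmod_ge0.
Qed.

Let sphere_max n : exists z, `|z - w| = r2c r /\ sqmod (peval h w) <= Phi n z.
Proof.
have Pw : Phi n w = sqmod (peval h w).
  rewrite /Phi big1 => [|j _]; last by rewrite subrr sqmod0.
  rewrite big1 => [|j ji]; last by rewrite Gw// sqmod0.
  by rewrite !mulr0 !addr0.
have wB : [set z | `|z - w| <= r2c r] w by rewrite /= subrr normr0 (r2c_le 0) ltW.
have [b bB bmax] := compact_EVT_max (ex_intro _ w wB) (@compact_cball R m w r)
  (continuous_subspaceT (@Phi_continuous n)).
exists b; rewrite inE /= in bB; split; last first.
  by rewrite -Pw; apply: bmax; rewrite inE.
apply/eqP; rewrite eq_le bB /=.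
have [//|br] := boolP (r2c r <= `|b - w|); exfalso.
have {}br : `|b - w| < r2c r.
  by move: br; rewrite norm_r2c r2c_le r2c_lt -ltNge.
have e0 : 0 < r - cre `|b - w| by rewrite subr_gt0 -r2c_lt -norm_r2c.
apply: (no_local_max e0) => z zb; apply: bmax; rewrite inE /=.
rewrite -(subrK b z) -addrA (le_trans (ler_normD _ _))//.
have -> : r2c r = r2c (r - cre `|b - w|) + `|b - w|.
  by rewrite [X in _ + X]norm_r2c -r2cD subrK.
by rewrite lerD2r ltW.
Qed.

(** The zero set of the m - 1 equations reaches the sphere, at a point where
    |h| is no smaller than at the centre. *)
Lemma max_principle_curve : exists z : Cspace R m, [/\ `|z - w| = r2c r,
  forall j, j != i0 -> peval (G j) z = 0 & `|peval h w| <= `|peval h z|].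
Proof.
(* The functions Phi n decrease with n, so a cluster point z of the maxima
   satisfies |h w|^2 <= Phi n z for every n. *)
have [u hu] := choice sphere_max.
have PhiS n z : Phi n.+1 z <= Phi n z.
  rewrite /Phi lerD ?lerD2l//.
    rewrite ler_wpM2r ?sumr_ge0// => [j _|]; first exact: sqmod_ge0.
    by rewrite lef_pV2 ?posrE// ler_nat.
  rewrite !mulNr lerN2 ler_wpM2r ?ler_nat// sumr_ge0// => j _.
  exact: sqmod_ge0.
have PhiD n k z : Phi (n + k) z <= Phi n z.
  elim: k => [|k IH]; first by rewrite addn0.
  by rewrite addnS (le_trans (PhiS _ _)).
have uB n : [set z | `|z - w| <= r2c r] (u n) by have [] := hu n => /= ->.
have [z [zB zcl]] := @compact_cball R m w r (u @ \oo) _ (filterE _ uB).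
have clos (F : Cspace R m -> R) (c : R) n : continuous F -> 
    (forall k, (n <= k)%N -> c <= F (u k)) -> c <= F z.
  move=> Fc hF; have /closure_id Acl : closed (F @^-1` [set x | c <= x]).
    by apply: preimage_closed; [move=> ? _; exact: Fc|exact: closed_ge].
  suff : (F @^-1` [set x | c <= x]) z by [].
  rewrite Acl => B Bz; apply: zcl => //.
  by exists n => // k /= nk; exact: hF.
have Phiz n : sqmod (peval h w) <= Phi n z.
  apply: (clos _ _ n) => // k nk.
  have [_ hk] := hu k; apply: le_trans hk _.
  by have := PhiD n (k - n)%N (u k); rewrite subnKC.
have zr : r <= cre `|z - w|.
  apply: (clos (fun z => cre `|z - w|) _ 0%N) => [|k _].
    exact: cnormB_continuous.
  by have [-> _] := hu k.
pose Q := \sum_j sqmod (z 0 j - w 0 j).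
pose S := \sum_(j | j != i0) sqmod (peval (G j) z).
have Q0 : 0 <= Q by apply: sumr_ge0 => *; exact: sqmod_ge0.
have S0 : 0 <= S by apply: sumr_ge0 => *; exact: sqmod_ge0.
have hw0 := sqmod_ge0 (peval h w).
have Qn n : n.+1%:R^-1 * Q <= Q.
  by rewrite ler_piMl// invf_le1// ler1n.
have {}S0 : S = 0.
  apply/eqP; rewrite eq_le S0 andbT; apply: (@natmul_bounded_le0 _ _ (sqmod (peval h z) + Q)) => n.
  have := Phiz n; have := Qn n; rewrite /Phi -/Q -/S mulNr.
  by move: (_^-1 * Q) (n%:R * S) => x y; lra.
exists z; split.
- by apply/eqP; rewrite eq_le zB norm_r2c r2c_le.
- move=> j ji; apply/eqP; rewrite -sqmod_eq0; apply/eqP; move: S0.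
  by move/psumr_eq0P; apply => // i _; exact: sqmod_ge0.
- rewrite -sqmod_le -subr_le0; apply: (@natmul_bounded_le0 _ _ Q) => n.
  have [n0|] := leP (sqmod (peval h w) - sqmod (peval h z)) 0.
    by rewrite (le_trans _ Q0)// mulr_ge0_le0.
  move=> d0; have := Phiz n; rewrite /Phi -/Q -/S S0 mulr0 addr0 addrC -lerBlDr.
  rewrite mulrC ler_pdivlMr// mulrC; apply: le_trans.
  by rewrite ler_pM2r// ler_nat.
Qed.

End MaximumPrinciple.

(** * Subspaces and closures in complex normed spaces *)

Section RealNorm.
Variable R : realType.

Definition rnorm (V : normedModType (Cplx R)) (v : V) : R := cre `|v|.

Variable V : normedModType (Cplx R).
Implicit Types (u v : V) (S : set V).

Lemma rnormE v : `|v| = r2c (rnorm v).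
Proof. exact: norm_r2c. Qed.

Lemma rnorm_ge0 v : 0 <= rnorm v.
Proof. exact: cre_norm_ge0. Qed.

Lemma rnorm0 : rnorm (0 : V) = 0.
Proof. by rewrite /rnorm normr0. Qed.

Lemma rnorm_eq0 v : rnorm v = 0 -> v = 0.
Proof. by move=> h; apply/eqP; rewrite -normr_eq0 rnormE h. Qed.

Lemma rnormN v : rnorm (- v) = rnorm v.
Proof. by rewrite /rnorm normrN. Qed.

Lemma rnormC u v : rnorm (u - v) = rnorm (v - u).
Proof. by rewrite /rnorm distrC. Qed.

Lemma rnormD u v : rnorm (u + v) <= rnorm u + rnorm v.
Proof. by rewrite -r2c_le r2cD -!rnormE ler_normD. Qed.

Lemma rnormZ (a : Cplx R) v : rnorm (a *: v) = rnorm a * rnorm v.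
Proof. by rewrite /rnorm normrZ [X in cre (X * _)]norm_r2c [X in cre (_ * X)]norm_r2c -r2cM. Qed.

Lemma rnorm_le v (x : R) : (`|v| <= r2c x) = (rnorm v <= x).
Proof. by rewrite rnormE r2c_le. Qed.

Lemma rnorm_lt v (x : R) : (`|v| < r2c x) = (rnorm v < x).
Proof. by rewrite rnormE r2c_lt. Qed.

Lemma nbhs_rnormP v (A : set V) : nbhs v A <->
  exists2 e : R, 0 < e & forall u, rnorm (v - u) < e -> A u.
Proof.
split.
  move=> /nbhs_ballP[e /= e0 eA]; have [ee re0] := r2c_gt0 e0.
  exists (cre e) => // y yv; apply: eA.
  by rewrite -ball_normE /= ee rnorm_lt.
move=> [e e0 eA]; apply/nbhs_ballP; exists (r2c e) => /=.
  by rewrite (r2c_lt 0).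
by move=> y; rewrite -ball_normE /= rnorm_lt; exact: eA.
Qed.

Lemma closure_rnormP S v : closure S v <->
  forall e : R, 0 < e -> exists2 s, S s & rnorm (v - s) < e.
Proof.
split => [cS e e0|h B /nbhs_rnormP[e e0 eB]].
  have [|s [Ss se]] := cS [set u | rnorm (v - u) < e].
    by apply/nbhs_rnormP; exists e.
  by exists s.
by have [s Ss se] := h e e0; exists s; split => //; exact: eB.
Qed.

Definition lin_closed S := S 0 /\ forall (a : Cplx R) u v, S u -> S v -> S (a *: u + v).

Lemma lin_closedD S u v : lin_closed S -> S u -> S v -> S (u + v).
Proof. by move=> [_ h] Su Sv; rewrite -[u]scale1r; exact: h. Qed.

Lemma lin_closedZ S (a : Cplx R) v : lin_closed S -> S v -> S (a *: v).
Proof. by move=> [h0 h] Sv; rewrite -[_ *: _]addr0; exact: h. Qed.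

Lemma lin_closedB S u v : lin_closed S -> S u -> S v -> S (u - v).
Proof. by move=> hS Su Sv; rewrite addrC -scaleN1r; apply: hS.2. Qed.

Lemma lin_closed_sum S n (c : 'I_n -> Cplx R) (e : 'I_n -> V) : lin_closed S ->
  (forall i, S (e i)) -> S (\sum_i c i *: e i).
Proof.
move=> hS he; apply: (big_ind S) => [|u v|i _]; first exact: hS.1.
  exact: lin_closedD.
exact: lin_closedZ.
Qed.

Lemma lin_closed_closure S : lin_closed S -> lin_closed (closure S).
Proof.
move=> hS; split; first by apply: subset_closure; exact: hS.1.
move=> a u v /closure_rnormP hu /closure_rnormP hv; apply/closure_rnormP => e e0.
have a1 : 0 < rnorm a + 1 by rewrite ltr_wpDl// cre_norm_ge0.
have e2 : 0 < e / 2 by rewrite divr_gt0.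
have [s Ss us] := hu (e / 2 / (rnorm a + 1)) (divr_gt0 e2 a1).
have [t St vt] := hv (e / 2) e2.
exists (a *: s + t); first exact: hS.2.
rewrite opprD addrACA -scalerBr.
apply: le_lt_trans (rnormD _ _) _; rewrite rnormZ [e]splitr ltr_leD ?(ltW vt)//.
apply: le_lt_trans (_ : _ <= (rnorm a + 1) * rnorm (u - s)) _.
  by rewrite ler_wpM2r ?rnorm_ge0// lerDl.
by rewrite mulrC -ltr_pdivlMr.
Qed.

End RealNorm.

Lemma sqr_rnorm_cplx (R : realType) (a : Cplx R) : rnorm a ^+ 2 = sqmod a.
Proof.
by have := sqmodE a; rewrite rnormE -r2cX => -[].
Qed.

Lemma rnorm_r2c (R : realType) (x : R) : 0 <= x -> rnorm (r2c x : Cplx R) = x.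
Proof. by move=> x0; rewrite /rnorm ger0_norm// (r2c_le 0). Qed.

Lemma rnormM (R : realType) (a b : Cplx R) : rnorm (a * b) = rnorm a * rnorm b.
Proof. exact: (rnormZ a (b : (Cplx R)^o)). Qed.

Lemma small_inv (R : realType) (e : R) : 0 < e -> exists n : nat, n.+1%:R^-1 < e.
Proof.
move=> e0; exists (Num.truncn e^-1).
by rewrite invf_plt ?posrE// truncnS_gt.
Qed.

(** * Uniform boundedness *)

Section Completeness.
Variables (R : realType) (H : completeNormedModType (Cplx R)).

Lemma complete_rate (rho : nat -> R) (u : nat -> H) :
  (forall n k, (n <= k)%N -> rnorm (u n - u k) <= rho n) ->
  (forall e, 0 < e -> exists n, rho n < e) ->
  exists2 h, (forall n, rnorm (u n - h) <= rho n) &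
    forall M : set H, closed M -> (forall n, M (u n)) -> M h.
Proof.
move=> uc rho0.
have cu : cauchy (u @ \oo).
  apply/cauchy_exP => e e0; have [ee re0] := r2c_gt0 e0.
  have [n hn] := rho0 _ re0; exists (u n); exists n => // k /= nk.
  rewrite -ball_normE /= ee rnorm_lt; exact: le_lt_trans (uc _ _ nk) hn.
have /cauchy_cvg/cvg_ex[h uh] := cu.
have key (M : set H) n : closed M -> (forall k, (n <= k)%N -> M (u k)) -> M h.
  move=> /closure_id cM hM; rewrite cM => B /uh[k _ hk].
  exists (u (maxn n k)); split; first exact/hM/leq_maxl.
  exact/hk/leq_maxr.
exists h => [n|M cM hM]; last by apply: (key M 0%N).
rewrite rnormC -rnorm_le.
apply: (key [set z | `|z - u n| <= r2c (rho n)] n); first exact: closed_cball.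
by move=> k nk /=; rewrite rnorm_le rnormC; exact: uc.
Qed.

(** If the family were not bounded, every ball would contain a smaller one on
    which some member exceeds a given integer; the family would be unbounded
    at the common point of the nested balls. *)
Lemma uniform_boundedness (I : Type) (E : I -> H -> Cplx R) :
  (forall i (a : Cplx R) u v, E i (a *: u + v) = a * E i u + E i v) ->
  (forall i, exists c, forall u, rnorm (E i u) <= c * rnorm u) ->
  (forall u, exists c, forall i, rnorm (E i u) <= c) ->
  exists2 C, 0 <= C & forall i u, rnorm (E i u) <= C * rnorm u.
Proof.
move=> lE bE pE; apply: contrapT => unb.
have {}unb C : 0 <= C -> exists i u, C * rnorm u < rnorm (E i u).
  move=> C0; apply: contrapT => h; apply: unb; exists C => // i u.
  by rewrite leNgt; apply/negP => h'; apply: h; exists i, u.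
have ED i u v : E i (u + v) = E i u + E i v by rewrite -[u]scale1r lE mul1r scale1r.
have E0 i : E i 0 = 0 by have := ED i 0 0; rewrite addr0 => /eqP; rewrite -subr_eq subrr => /eqP.
have EZ i a u : E i (a *: u) = a * E i u by have := lE i a u 0; rewrite E0 !addr0.
have step (a : nat * (H * R)) : exists b : H * R, 0 < a.2.2 ->
    [/\ 0 < b.2, b.2 <= a.1.+1%:R^-1, rnorm (a.2.1 - b.1) + b.2 <= a.2.2 &
     exists i, forall y, rnorm (b.1 - y) <= b.2 -> a.1%:R < rnorm (E i y)].
  case: a => n [x r] /=; have [r0|r0] := ltP 0 r; last first.
    by exists (x, r) => /=; rewrite ltNge r0.
  have C0 : 0 <= 4 * n.+1%:R / r by rewrite divr_ge0 ?mulr_ge0 ?(ltW r0).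
  have [i [f hf]] := unb _ C0.
  have f0 : 0 < rnorm f.
    rewrite lt_neqAle rnorm_ge0 andbT; apply/eqP => /esym /rnorm_eq0 f0.
    by move: hf; rewrite f0 E0 !rnorm0 mulr0 ltxx.
  (* A vector of norm r / 2 on which E i is large: it cannot be small at both
     x and x + g. *)
  pose g := r2c (r / 2 / rnorm f) *: f.
  have rf0 : 0 <= r / 2 / rnorm f by rewrite !divr_ge0 ?(ltW r0) ?(ltW f0).
  have gr : rnorm g = r / 2 by rewrite rnormZ rnorm_r2c// divfK// gt_eqF.
  have Eg : 2 * n.+1%:R < rnorm (E i g).
    rewrite EZ rnormM rnorm_r2c//.
    have -> : 2 * n.+1%:R = r / 2 / rnorm f * (4 * n.+1%:R / r * rnorm f).
      by field; rewrite !gt_eqF.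
    by rewrite ltr_pM2l// !divr_gt0.
  have [x' xx' Ex'] : exists2 x', rnorm (x - x') <= r / 2 & n.+1%:R < rnorm (E i x').
    have [h|h] := ltP n.+1%:R (rnorm (E i x)).
      by exists x => //; rewrite subrr rnorm0 divr_ge0// ltW.
    exists (x + g); first by rewrite opprD addrA subrr add0r rnormN gr.
    have : rnorm (E i g) <= rnorm (E i (x + g)) + rnorm (E i x).
      by rewrite -(rnormN (E i x)) (le_trans _ (rnormD _ _))// ED addrC addKr.
    by lra.
  have [c hc] := bE i.
  pose r' := Num.min (r / 2) (Num.min n.+1%:R^-1 (`|c| + 1)^-1).
  have c1 : 0 < `|c| + 1 by rewrite ltr_wpDl.
  exists (x', r') => _ /=; split.
  - by rewrite !lt_min !invr_gt0 c1 ltr0Sn divr_gt0.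
  - by rewrite !ge_min lexx orbT.
  - by rewrite [leRHS]splitr lerD// ge_min lexx.
  - exists i => y yr.
    have h1 : rnorm (E i x') <= rnorm (E i y) + rnorm (E i (x' - y)).
      by rewrite (le_trans _ (rnormD _ _))// -ED addrC subrK.
    have h2 : rnorm (E i (x' - y)) <= 1.
      apply: le_trans (hc _) _; apply: le_trans (_ : _ <= (`|c| + 1) * r') _.
        apply: le_trans (_ : _ <= (`|c| + 1) * rnorm (x' - y)) _.
          by rewrite ler_wpM2r ?rnorm_ge0// ler_wpDr// ler_norm.
        by rewrite ler_wpM2l// ltW.
      by rewrite -ler_pdivlMl// mulr1 !ge_min lexx !orbT.
    by move: Ex'; rewrite -natr1; lra.
have [F hF] := choice step.
pose s := fix s n : H * R := if n is k.+1 then F (k, s k) else (0, 1).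
have sr n : 0 < (s n).2.
  by elim: n => [|n IH] /=; [exact: ltr01|have [] := hF (n, s n) IH].
have sS n := hF (n, s n) (sr n).
have sk n k : rnorm ((s n).1 - (s (n + k)%N).1) + (s (n + k)%N).2 <= (s n).2.
  elim: k => [|k IH]; first by rewrite addn0 subrr rnorm0 add0r.
  rewrite addnS; have [_ _ + _] := sS (n + k)%N => /= h.
  have := rnormD ((s n).1 - (s (n + k)%N).1) ((s (n + k)%N).1 - (s (n + k).+1).1).
  by rewrite addrA subrK /=; lra.
have [n k nk|e e0|h hh _] := @complete_rate (fun n => (s n).2) (fun n => (s n).1).
- have := sk n (k - n)%N; rewrite subnKC// => {}nk.
  by have := sr k; lra.
- have [n hn] := small_inv e0; exists n.+1.
  by have [_ h _ _] := sS n; exact: le_lt_trans h hn.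
have [c hc] := pE h.
have [_ _ _ [i hi]] := sS (Num.truncn c).+1.
have := lt_le_trans (hi h (hh (Num.truncn c).+2)) (hc i).
by rewrite ltNge (ltW (truncnS_gt c)).
Qed.

End Completeness.

(** * Riesz representation and dual bases *)

Section Hilbert.
Variables (R : realType) (H : completeNormedModType (Cplx R)).
Variable dot : {dot H for @Num.conj (Cplx R)}.
Hypothesis dot_norm : forall f, `|f| ^+ 2 = dot f f.
Implicit Types (u v f g : H) (a : Cplx R) (M S : set H).

Lemma dotDl u v f : dot (u + v) f = dot u f + dot v f.
Proof. exact: linearDl. Qed.
Lemma dotZl a u f : dot (a *: u) f = a * dot u f.
Proof. exact: linearZl_LR. Qed.
Lemma dotC u v : dot u v = (dot v u)^*.
Proof. by rewrite (hermC dot) expr0 mul1r. Qed.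
Lemma dotDr u v f : dot f (u + v) = dot f u + dot f v.
Proof. exact: linearDr. Qed.
Lemma dotZr a u f : dot f (a *: u) = a^* * dot f u.
Proof. exact: linearZr_LR. Qed.
Lemma dotNl u f : dot (- u) f = - dot u f.
Proof. exact: linearNl. Qed.
Lemma dotNr u f : dot f (- u) = - dot f u.
Proof. exact: linearNr. Qed.
Lemma dotBl u v f : dot (u - v) f = dot u f - dot v f.
Proof. by rewrite dotDl dotNl. Qed.
Lemma dotBr u v f : dot f (u - v) = dot f u - dot f v.
Proof. by rewrite dotDr dotNr. Qed.
Lemma dot0r f : dot f 0 = 0.
Proof. exact: linear0r. Qed.
Lemma dot_suml n (c : 'I_n -> Cplx R) (e : 'I_n -> H) f :
  dot (\sum_i c i *: e i) f = \sum_i c i * dot (e i) f.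
Proof. by rewrite linear_sumlz; apply: eq_bigr => i _; exact: dotZl. Qed.
Lemma dot_sumr n (c : 'I_n -> Cplx R) (e : 'I_n -> H) f :
  dot f (\sum_i c i *: e i) = \sum_i (c i)^* * dot f (e i).
Proof. by rewrite linear_sumr; apply: eq_bigr => i _; exact: dotZr. Qed.

Lemma dotff f : dot f f = r2c (rnorm f ^+ 2).
Proof. by rewrite -dot_norm rnormE r2cX. Qed.

Lemma creJ a : cre a^* = cre a.
Proof. by case: a. Qed.
Lemma cimJ a : cim a^* = - cim a.
Proof. by case: a. Qed.

Lemma sqr_rnormDZ u v a :
  rnorm (u + a *: v) ^+ 2 = rnorm u ^+ 2 + 2 * cre (a * dot v u) + sqmod a * rnorm v ^+ 2.
Proof.
have -> : rnorm (u + a *: v) ^+ 2 = cre (dot (u + a *: v) (u + a *: v)).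
  by rewrite dotff.
rewrite dotDl !dotDr !dotZl !dotZr (dotC u v) !dotff -rmorphM.
rewrite !creD creJ !creM !cimM creJ cimJ /sqmod /cre /cim /=; ring.
Qed.

Lemma quad_bound (A B D : R) : 0 <= B -> 0 <= D ->
  (forall t : R, 0 <= A - 2 * t * D + t ^+ 2 * D * B) -> D <= A * B.
Proof.
move=> B0 D0 h; have [B1|B1] := ltP 0 B.
  have := h B^-1; rewrite -(pmulr_lge0 _ B1).
  have -> : (A - 2 * B^-1 * D + B^-1 ^+ 2 * D * B) * B = A * B - D.
    by field; rewrite gt_eqF.
  by rewrite subr_ge0.
have -> : B = 0 by apply/eqP; rewrite eq_le B1.
rewrite mulr0 leNgt; apply/negP => D1.
have := h ((A + 1) / (2 * D)).
have B00 : B = 0 by apply/eqP; rewrite eq_le B1.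
have -> : A - 2 * ((A + 1) / (2 * D)) * D + ((A + 1) / (2 * D)) ^+ 2 * D * B = -1.
  by rewrite B00; field; rewrite gt_eqF.
by rewrite ler0N1.
Qed.

(** Common core of the Cauchy-Schwarz inequality and of the Riesz theorem:
    the bound results from the best multiple b of the conjugate of a. *)
Lemma opt_bound v (A : R) a : 
  (forall b : Cplx R, 0 <= A + 2 * cre (b * a) + sqmod b * rnorm v ^+ 2) ->
  sqmod a <= A * rnorm v ^+ 2.
Proof.
move=> h; apply: quad_bound; [exact: sqr_ge0|exact: sqmod_ge0|move=> t].
have := h (- (r2c t * a^*)).
have -> : cre (- (r2c t * a^*) * a) = - t * sqmod a.
  rewrite !(creM,cimM,creN,cimN,creJ,cimJ) /sqmod /cre /cim /=; ring.
have -> : sqmod (- (r2c t * a^*)) = t ^+ 2 * sqmod a.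
  rewrite /sqmod !(creM,cimM,creN,cimN,creJ,cimJ) /cre /cim /=; ring.
congr (_ <= _); ring.
Qed.

Lemma cauchy_schwarz u v : rnorm (dot u v) <= rnorm u * rnorm v.
Proof.
rewrite -ler_sqr ?nnegrE ?rnorm_ge0 ?mulr_ge0 ?rnorm_ge0// sqr_rnorm_cplx exprMn mulrC.
rewrite dotC (_ : sqmod _ = sqmod (dot v u)); last first.
  by rewrite /sqmod creJ cimJ sqrrN.
rewrite mulrC; apply: (@opt_bound v) => b.
by rewrite -sqr_rnormDZ sqr_ge0.
Qed.

Lemma sqr_rnormD u v : rnorm (u + v) ^+ 2 = rnorm u ^+ 2 + 2 * cre (dot v u) + rnorm v ^+ 2.
Proof.
rewrite -{1}[v]scale1r sqr_rnormDZ mul1r.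
by rewrite (_ : sqmod 1 = 1) ?mul1r// /sqmod /cre /cim /= expr1n expr0n addr0.
Qed.

Lemma sqr_rnormB u v : rnorm (u - v) ^+ 2 = rnorm u ^+ 2 - 2 * cre (dot v u) + rnorm v ^+ 2.
Proof. by rewrite sqr_rnormD rnormN dotNl creN mulrN. Qed.

(** A minimising sequence of |u|^2 - 2 Re phi(u) over M is Cauchy by the
    parallelogram identity.  That u_n is a minimiser up to q n bounds
    dot f u_n - phi f, by opt_bound applied to the perturbations u_n + b f;
    the limit represents phi. *)
Lemma riesz M (phi : H -> Cplx R) (c : R) : closed M -> lin_closed M ->
  (forall a u v, M u -> M v -> phi (a *: u + v) = a * phi u + phi v) ->
  (forall u, M u -> rnorm (phi u) <= c * rnorm u) ->
  exists2 h, M h & forall f, M f -> phi f = dot f h.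
Proof.
move=> cM [M0 lM] lphi bphi.
pose J u := rnorm u ^+ 2 - 2 * cre (phi u).
have Jc u : M u -> - c ^+ 2 <= J u.
  move=> Mu; have h1 := bphi u Mu; have h2 := cre_le (phi u).
  have h3 := ler_norm (cre (phi u)).
  have : cre (phi u) <= c * rnorm u by rewrite (le_trans h3)// (le_trans h2).
  by have := sqr_ge0 (rnorm u - c); rewrite /J; nra.
pose A := J @` M.
have infA : has_inf A.
  split; first by exists (J 0), 0.
  by exists (- c ^+ 2) => _ [u Mu <-]; exact: Jc.
pose d := inf A.
have Jd u : M u -> d <= J u.
  by move=> Mu; apply: ge_inf; [exact: infA.2|exists u].
(* q n stands for 1 / (n + 1). *)
have [q [q0 qd qs qE]] : exists q : nat -> R, [/\ forall n, 0 < q n,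
    forall n k, (n <= k)%N -> q k <= q n, forall e, 0 < e -> exists n, q n < e &
    forall n x, 0 <= x -> n%:R * (q n * x) <= x].
  exists (fun n => n.+1%:R^-1); split => [n|n k nk||n x x0].
  - by rewrite invr_gt0.
  - by rewrite lef_pV2 ?posrE// ler_nat.
  - exact: small_inv.
  - by rewrite mulrA ler_piMl// ler_pdivrMr// mul1r ler_nat.
have Ju (n : nat) : exists u, M u /\ J u < d + q n.
  have [_ [u Mu <-] hu] := inf_adherent (q0 n) infA.
  by exists u.
have [u hu] := choice Ju.
have Mu n : M (u n) by have [] := hu n.
have par x y : M x -> M y -> rnorm (x - y) ^+ 2 <= 2 * (J x + J y - 2 * d).
  move=> Mx My.
  have Mxy : M (x + y) by rewrite -[x]scale1r; exact: lM.
  have Mz : M (r2c 2^-1 *: (x + y)) by rewrite -[_ *: _]addr0; exact: lM.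
  have phiz : cre (phi (r2c 2^-1 *: (x + y))) = 2^-1 * (cre (phi x) + cre (phi y)).
    have p0 : phi 0 = 0.
      have := lphi 1 0 0 M0 M0; rewrite scaler0 addr0 mul1r => /eqP.
      by rewrite -subr_eq subrr => /eqP.
    have := lphi (r2c 2^-1) _ _ Mxy M0; rewrite addr0 p0 addr0 => ->.
    have := lphi 1 _ _ Mx My; rewrite scale1r mul1r => ->.
    by rewrite cre_r2cM creD.
  have := Jd _ Mz; rewrite /J phiz rnormZ rnorm_r2c ?invr_ge0// exprMn.
  rewrite sqr_rnormB sqr_rnormD; lra.
have uk n k : (n <= k)%N -> rnorm (u n - u k) ^+ 2 <= 4 * q n.
  move=> nk; apply: le_trans (par _ _ (Mu n) (Mu k)) _.
  have [_ h1] := hu n; have [_ h2] := hu k.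
  by have := qd _ _ nk; lra.
have [n k nk|e e0|h hh hM] := @complete_rate R H (fun n => 2 * Num.sqrt (q n)) u.
- rewrite -ler_sqr ?nnegrE ?rnorm_ge0 ?mulr_ge0 ?sqrtr_ge0//.
  rewrite exprMn sqr_sqrtr ?(ltW (q0 _))// (le_trans (uk _ _ nk))//; lra.
- have [n hn] := qs _ (exprn_gt0 2 (divr_gt0 e0 (ltr0Sn R 1))).
  exists n; rewrite mulrC -ltr_pdivlMr// -ltr_sqr ?nnegrE ?sqrtr_ge0//.
    by rewrite sqr_sqrtr ?(ltW (q0 _)).
  by rewrite divr_ge0// ltW.
exists h; first exact: hM.
move=> f Mf.
have en n : sqmod (dot f (u n) - phi f) <= q n * rnorm f ^+ 2.
  apply: opt_bound => b; have [_ un] := hu n.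
  have := Jd (b *: f + u n) (lM _ _ _ Mf (Mu n)).
  rewrite /J lphi// [b *: f + _]addrC sqr_rnormDZ mulrBr creB creD.
  by move: un; rewrite /J; lra.
suff : sqmod (dot f h - phi f) <= 0.
  move=> h0; have : sqmod (dot f h - phi f) == 0 by rewrite eq_le h0 sqmod_ge0.
  by rewrite sqmod_eq0 subr_eq0 => /eqP.
apply: (@natmul_bounded_le0 _ _ (10 * rnorm f ^+ 2)) => n.
have h1 : sqmod (dot f (h - u n)) <= 4 * q n * rnorm f ^+ 2.
  rewrite -sqr_rnorm_cplx (le_trans (_ : _ <= (rnorm f * rnorm (h - u n)) ^+ 2))//.
    by rewrite ler_sqr ?nnegrE ?mulr_ge0 ?rnorm_ge0// cauchy_schwarz.
  rewrite exprMn mulrC ler_wpM2r ?sqr_ge0//.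
  rewrite rnormC (le_trans (_ : _ <= (2 * Num.sqrt (q n)) ^+ 2))//.
    by rewrite ler_sqr ?nnegrE ?mulr_ge0 ?rnorm_ge0 ?sqrtr_ge0.
  by rewrite exprMn sqr_sqrtr ?(ltW (q0 _))//; lra.
have h2 : sqmod (dot f h - phi f) <=
    2 * sqmod (dot f (h - u n)) + 2 * sqmod (dot f (u n) - phi f).
  rewrite (_ : dot f h - phi f = dot f (h - u n) + (dot f (u n) - phi f)).
    exact: sqmodD_le.
  by rewrite dotBr; ring.
have h3 : sqmod (dot f h - phi f) <= q n * (10 * rnorm f ^+ 2).
  by have := en n; move: h1 h2; lra.
apply: le_trans (_ : n%:R * (q n * (10 * rnorm f ^+ 2)) <= _).
  by rewrite ler_wpM2l.
by apply: qE; rewrite mulr_ge0 ?sqr_ge0.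
Qed.

Lemma orth_closure S g : (forall s, S s -> dot s g = 0) ->
  forall f, closure S f -> dot f g = 0.
Proof.
move=> Sg f /closure_rnormP cf; apply: rnorm_eq0; apply/eqP.
rewrite eq_le rnorm_ge0 andbT leNgt; apply/negP => d0.
have g1 : 0 < rnorm g + 1 by rewrite ltr_wpDl// rnorm_ge0.
have [s Ss sf] := cf _ (divr_gt0 d0 g1).
move: sf; rewrite ltr_pdivlMr// ltNge => /negP; apply.
rewrite -[X in dot X g](subrK s) dotDl (Sg s)// addr0.
apply: le_trans (cauchy_schwarz _ _) _.
by rewrite ler_wpM2l ?rnorm_ge0// lerDl.
Qed.

(** The orthogonal complement of D is dual to S modulo D.  The component of
    f i orthogonal to N i is nonzero, is killed by D and by the other f j, and
    so gives, up to a scalar, the i-th member of a dual basis. *)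
Lemma orth_dim S (D : set H) n (f : 'I_n -> H) (N : 'I_n -> set H) :
  lin_closed S -> (forall i, lin_closed (N i)) -> (forall i, N i `<=` S) ->
  (forall i, S (f i)) -> (forall i, D `<=` N i) ->
  (forall i j, j != i -> N i (f j)) -> (forall i, ~ closure (N i) (f i)) ->
  (forall s, S s -> exists c : 'I_n -> Cplx R,
     exists2 d, D d & s = \sum_i c i *: f i + d) ->
  has_dim [set g | closure S g /\ forall d, D d -> dot d g = 0] n.
Proof.
move=> lS lN NS Sf DN Nf fN dec.
have Sc := @subset_closure _ S.
have lcS := lin_closed_closure lS.
have ex i : exists e, [/\ closure S e, dot (f i) e = 1 &
    forall s, N i s -> dot s e = 0].
  have [h Nh hE] := @riesz (closure (N i)) (fun u => dot u (f i)) (rnorm (f i))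
    (@closed_closure _ _) (lin_closed_closure (lN i))
    (fun a u v _ _ => etrans (dotDl _ _ _) (congr1 (+%R^~ _) (dotZl _ _ _)))
    (fun u _ => etrans (congr1 (fun x => rnorm (dot u (f i)) <= x) (mulrC _ _)) (cauchy_schwarz _ _)).
  pose x := f i - h.
  have x0 : rnorm x != 0.
    by apply/eqP => /rnorm_eq0 /eqP; rewrite subr_eq0 => /eqP fh; apply: (fN i); rewrite fh.
  have xN s : closure (N i) s -> dot s x = 0.
    by move=> Ns; rewrite dotBr -hE// subrr.
  have xf : dot (f i) x = r2c (rnorm x ^+ 2).
    by rewrite -dotff {2}/x dotBl (xN h)// subr0.
  exists (r2c (rnorm x ^+ 2)^-1 *: x); split.
  - apply: (@lin_closedZ _ _ (closure S)) => //.
    apply: (@lin_closedB _ _ (closure S)) => //; first exact: Sc.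
    exact: closureS (NS i) _ Nh.
  - rewrite dotZr xf (_ : (r2c _)^* = r2c (rnorm x ^+ 2)^-1); last first.
      by apply: cplxP; rewrite ?creJ ?cimJ /cre /cim //= oppr0.
    by rewrite -r2cM mulVf// expf_neq0.
  - by move=> s Ns; rewrite dotZr xN ?mulr0//; exact: subset_closure.
have [e he] := choice ex.
have fe i j : dot (f i) (e j) = (i == j)%:R.
  have [<-|ij] := eqVneq i j; first by have [] := he i.
  by have [_ _ h] := he j; apply: h; apply: Nf.
have De i d : D d -> dot d (e i) = 0.
  by move=> Dd; have [_ _ h] := he i; apply: h; apply: DN.
have dsum (c : 'I_n -> Cplx R) i : dot (f i) (\sum_j c j *: e j) = (c i)^*.
  rewrite dot_sumr (bigD1 i)//= fe eqxx mulr1 big1 ?addr0// => j ji.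
  by rewrite fe eq_sym (negbTE ji) mulr0.
have Dsum (c : 'I_n -> Cplx R) d : D d -> dot d (\sum_j c j *: e j) = 0.
  by move=> Dd; rewrite dot_sumr big1// => j _; rewrite De// mulr0.
have eS i : closure S (e i) by have [] := he i.
exists e; split.
  move=> c c0 i; apply: (can_inj (@conjCK _)).
  by rewrite -dsum c0 dot0r rmorph0.
apply/seteqP; split => [g [Sg Dg]|_ [c ->]]; last first.
  by split => [|d Dd]; [exact: (@lin_closed_sum _ _ (closure S))|exact: Dsum].
exists (fun i => (dot (f i) g)^*); apply/eqP; rewrite -subr_eq0.
set g' := (X in g - X).
have Sg' : closure S (g - g').
  apply: (@lin_closedB _ _ (closure S)) => //.
  exact: (@lin_closed_sum _ _ (closure S)).
suff : dot (g - g') (g - g') = 0.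
  move/eqP; rewrite dotff -[0]/(r2c 0) => /eqP [] /eqP.
  by rewrite expf_eq0 /= => /eqP/rnorm_eq0 ->.
apply: orth_closure Sg' => s /dec[c [d Dd ->]].
rewrite dotDl (_ : dot d _ = 0) ?addr0; last by rewrite dotBr Dg// Dsum// subrr.
rewrite dot_suml big1// => i _.
by rewrite dotBr dsum conjCK subrr mulr0.
Qed.

End Hilbert.

(** * A transversal slice of a submanifold *)

Section Frechet.
Variable R : realType.

Lemma mulmx_bound m n (D : 'M[Cplx R]_(m, n)) :
  exists2 B : R, 0 <= B & forall x : 'rV_m, rnorm (x *m D) <= B * rnorm x.
Proof.
exists (\sum_k \sum_j rnorm (D j k)).
  by do 2 (apply: sumr_ge0 => ? _); exact: cre_norm_ge0.
move=> x; rewrite -rnorm_le; apply: norm_rV_le.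
  by rewrite (r2c_le 0) mulr_ge0 ?rnorm_ge0//; do 2 (apply: sumr_ge0 => ? _); exact: cre_norm_ge0.
move=> k; rewrite rnorm_le mxE.
apply: (@le_trans _ _ (\sum_j rnorm (D j k) * rnorm x)).
  elim/big_ind2: _ => [|a b c d h1 h2|j _]; first by rewrite rnorm0.
    by rewrite (le_trans (rnormD _ _)) ?lerD.
  rewrite rnormM mulrC ler_wpM2l ?cre_norm_ge0//.
  by rewrite -rnorm_le -rnormE; exact: norm_rV_coord.
rewrite -mulr_suml ler_wpM2r ?rnorm_ge0// (bigD1 k)//= lerDl.
by do 2 (apply: sumr_ge0 => ? _); exact: cre_norm_ge0.
Qed.

Lemma frechet m n (f : Cspace R m -> Cspace R n) (a : Cspace R m) :
  differentiable f a -> exists D : 'M[Cplx R]_(m, n), forall e : R, 0 < e ->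
  exists2 d : R, 0 < d & forall z, rnorm (z - a) < d ->
    rnorm (f z - f a - (z - a) *m D) <= e * rnorm (z - a).
Proof.
move=> df; exists (lin1_mx ('d f a)) => e e0.
have [_ /eqaddoP] := (diff_locallyP _ _).1 df.
have rce : 0 < r2c e by rewrite (r2c_lt 0).
move=> /(_ _ rce) /nbhs_rnormP[d d0 hd]; exists d => // z zd.
have zd' : rnorm (0 - (z - a)) < d by rewrite sub0r rnormN.
have := hd _ zd'; rewrite !fctE /= subrK opprD addrA mul_rV_lin1.
by rewrite [X in _ <= r2c _ * X]rnormE -r2cM rnorm_le.
Qed.

End Frechet.

Section Isolation.
Variables (R : realType) (m : nat).

(** The l_j are the coordinates, from t on, of the derivative D of a chart
    phi.  A point z of V on the slice satisfies phi(z)_j = phi(w)_j for j < t,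
    and phi(z)_j - phi(w)_j = o(|z - w|) for the other j; since the inverse of
    phi is Lipschitz at phi(w), this forces |z - w| = o(|z - w|). *)
Lemma submanifold_slice (Omega V : set (Cspace R m)) (t : nat) (w : Cspace R m) :
  complex_submanifold Omega V t -> V w -> (t <= m)%N /\
  exists (l : 'I_m -> Cpoly R m) (r : R), [/\ 0 < r, forall j, peval (l j) w = 0,
    forall z, rnorm (z - w) <= r -> Omega z &
    forall z, rnorm (z - w) <= r -> V z ->
      (forall j : 'I_m, (t <= j)%N -> peval (l j) z = 0) -> z = w].
Proof.
move=> [_ hV] Vw; have [tm [U [phi [Uw UO bi UV]]]] := hV w Vw.
split=> //; have [oU ophiU hphi [psi [hpsi psiK]]] := bi.
have [D hD] := frechet (hphi w Uw).
have [D' hD'] := frechet (hpsi (phi w) (imageP phi Uw)).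
have [B B0 hB] := mulmx_bound D.
have [B' B'0 hB'] := mulmx_bound D'.
pose l (j : 'I_m) : Cpoly R m :=
  \sum_k mpoly.mpolyC m (D k j) * (poly_var R k - mpoly.mpolyC m (w 0 k)).
have lE j z : peval (l j) z = ((z - w) *m D) 0 j.
  rewrite peval_sum mxE; apply: eq_bigr => k _.
  by rewrite pevalM pevalB pevalC peval_var pevalC !mxE mulrC.
pose C := B' + 1; have C0 : 0 < C by rewrite ltr_wpDl.
(* C is a Lipschitz constant at phi w of the inverse of phi. *)
have e0 : 0 < (2 * C)^-1 by rewrite invr_gt0 mulr_gt0.
have [d d0 hd] := hD _ e0.
have [d' d'0 hd'] := hD' 1 ltr01.
have [d2 d20 U2] := (nbhs_rnormP _ _).1 (open_nbhs_nbhs (conj oU Uw)).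
have B10 : 0 < B + (2 * C)^-1 by rewrite ltr_wpDl.
pose r := Num.min (d / 2) (Num.min (d2 / 2) (d' / (2 * (B + (2 * C)^-1)))).
have r0 : 0 < r by rewrite !lt_min !divr_gt0// mulr_gt0.
have rd z : rnorm (z - w) <= r -> [/\ rnorm (z - w) < d, U z &
    (B + (2 * C)^-1) * rnorm (z - w) < d'].
  rewrite !le_min => /and3P[h1 h2 h3]; split.
  - by apply: le_lt_trans h1 _; rewrite ltr_pdivrMr// ltr_pMr// ltr1n.
  - apply: U2; rewrite rnormC; apply: le_lt_trans h2 _.
    by rewrite ltr_pdivrMr// ltr_pMr// ltr1n.
  - rewrite mulrC -ltr_pdivlMr//; apply: le_lt_trans h3 _.
    rewrite invfM mulrA ltr_pM2r ?invr_gt0//.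
    by rewrite ltr_pdivrMr// ltr_pMr// ltr1n.
exists l, r; split => // [j|z /rd[_ Uz _]|z /rd[zd Uz zd'] Vz lz].
- by rewrite lE subrr mul0mx mxE.
- exact: UO.
apply/eqP; rewrite -subr_eq0; apply/eqP/rnorm_eq0.
have h1 := hd z zd.
have phi_d' : rnorm (phi z - phi w) < d'.
  apply: le_lt_trans zd'; rewrite mulrDl -[phi z - phi w](subrK ((z - w) *m D)).
  by rewrite addrC (le_trans (rnormD _ _))// lerD// addrAC.
have h2 := hd' _ phi_d'; rewrite !psiK// mul1r in h2.
have h3 : rnorm (z - w) <= C * rnorm (phi z - phi w).
  rewrite -[z - w](subrK ((phi z - phi w) *m D')) (le_trans (rnormD _ _))//.
  by rewrite mulrDl mul1r addrC lerD.
have h4 : rnorm (phi z - phi w) <= (2 * C)^-1 * rnorm (z - w).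
  rewrite -rnorm_le; apply: norm_rV_le.
    by rewrite (r2c_le 0) mulr_ge0 ?rnorm_ge0// ltW.
  move=> j; have [jt|tj] := ltnP j t.
    have := (UV z Uz).1 Vz j jt; have := (UV w Uw).1 Vw j jt.
    rewrite !mxE => -> ->; rewrite subrr normr0 (r2c_le 0).
    by rewrite mulr_ge0 ?rnorm_ge0// ltW.
  apply: le_trans (_ : _ <= `|phi z - phi w - (z - w) *m D|) _; last by rewrite rnorm_le.
  apply: le_trans (norm_rV_coord _ j).
  have := lz j tj; rewrite lE => zj.
  by rewrite [X in _ <= `|X|]mxE [X in _ <= `|_ + X|]mxE zj oppr0 addr0.
apply/eqP; rewrite eq_le rnorm_ge0 andbT.
have : rnorm (z - w) <= C * ((2 * C)^-1 * rnorm (z - w)).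
  by rewrite (le_trans h3)// ler_wpM2l// ltW.
have -> : C * ((2 * C)^-1 * rnorm (z - w)) = rnorm (z - w) / 2.
  by field; rewrite gt_eqF.
by move: (rnorm (z - w)) => x; lra.
Qed.

End Isolation.

(** * The joint kernel as an orthogonal complement *)

Section Module.
Variables (R : realType) (m : nat) (Omega : set (Cspace R m)).
Variables (H : completeNormedModType (Cplx R)) (dot : {dot H for @Num.conj (Cplx R)}).
Variable ev : H -> Cspace R m -> Cplx R.
Hypothesis AHM : analytic_hilbert_module Omega dot ev.
Implicit Types (f g : H) (q : Cpoly R m) (z w : Cspace R m).

Let dot_norm : forall f, `|f| ^+ 2 = dot f f := ahm_norm AHM.

Lemma evP (a : Cplx R) f g z : Omega z -> ev (a *: f + g) z = a * ev f z + ev g z.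
Proof. exact: (ahm_linear AHM). Qed.

Lemma evD f g z : Omega z -> ev (f + g) z = ev f z + ev g z.
Proof. by move=> Oz; rewrite -[f]scale1r evP// mul1r scale1r. Qed.

Lemma ev0 z : Omega z -> ev 0 z = 0.
Proof.
move=> Oz; have := evD 0 0 Oz; rewrite addr0 => /eqP.
by rewrite -subr_eq subrr => /eqP.
Qed.

Lemma evZ (a : Cplx R) f z : Omega z -> ev (a *: f) z = a * ev f z.
Proof. by move=> Oz; rewrite -[_ *: _]addr0 evP// ev0// addr0. Qed.

Lemma evB f g z : Omega z -> ev (f - g) z = ev f z - ev g z.
Proof. by move=> Oz; rewrite evD// -scaleN1r evZ// mulN1r. Qed.

Lemma ev_sum n (F : 'I_n -> H) z : Omega z ->
  ev (\sum_i F i) z = \sum_i ev (F i) z.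
Proof.
move=> Oz; apply: (big_morph (fun f => ev f z)) => [f g|]; first exact: evD.
exact: ev0.
Qed.

Lemma ev_inj f g : (forall z, Omega z -> ev f z = ev g z) -> f = g.
Proof. exact: (ahm_inj AHM). Qed.

Lemma ev_dot w : Omega w -> exists k, forall f, ev f w = dot f k.
Proof. by have [K [h _ _]] := ahm_kernel AHM => /h[k _ hk]; exists k. Qed.

(** The functions of the module are bounded on the compact ball, so the
    evaluations at its points are uniformly bounded functionals. *)
Lemma ev_bounded_on_ball w (r : R) : (forall z, rnorm (z - w) <= r -> Omega z) ->
  exists2 C, 0 <= C & forall z f, rnorm (z - w) <= r -> rnorm (ev f z) <= C * rnorm f.
Proof.
move=> rO; pose I := {z | rnorm (z - w) <= r}.
have OI (i : I) : Omega (sval i) by apply: rO; exact: (svalP i).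
have [i a u v|i|u|C C0 hC] := @uniform_boundedness R H I (fun i f => ev f (sval i)).
- exact: evP.
- have [k hk] := ev_dot (OI i); exists (rnorm k) => u.
  by rewrite hk mulrC; exact: (cauchy_schwarz dot_norm).
- have [r0|r0] := leP 0 r; last first.
    exists 0 => -[z zr]; exfalso; have := lt_le_trans r0 (rnorm_ge0 (z - w)).
    by rewrite ltNge zr.
  have cK := @compact_cball R m w r.
  have wK : [set z | `|z - w| <= r2c r] w by rewrite /= subrr normr0 (r2c_le 0).
  have evc : {within [set z | `|z - w| <= r2c r], continuous (fun z => rnorm (ev u z))}.
    apply: continuous_in_subspaceT => z; rewrite inE /= rnorm_le => /rO Oz.
    have evc := differentiable_continuous (ahm_holomorphic AHM u Oz).
    apply: (continuous_comp evc).
    have := @cnormB_continuous R _ (0 : (Cplx R)^o) (ev u z).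
    by under eq_fun do rewrite subr0.
  have [c _ hc] := compact_EVT_max (ex_intro _ w wK) cK evc.
  exists (rnorm (ev u c)) => -[z zr] /=; apply: hc.
  by rewrite inE /= rnorm_le.
exists C => // z f zr; exact: (hC (exist _ z zr)).
Qed.

Lemma mulopP q f z : Omega z -> ev (mulop Omega ev q f) z = peval q z * ev f z.
Proof.
rewrite /mulop; case: xgetP => [g _ hg|hN]; first exact: hg.
by have [c /(_ f)[g hg _]] := ahm_mul AHM q; have := hN g.
Qed.

Lemma mulop_bound q : exists c : R, forall f, rnorm (mulop Omega ev q f) <= c * rnorm f.
Proof.
have [c hc] := ahm_mul AHM q; exists (cre c) => f.
have [g hg gc] := hc f.
have -> : mulop Omega ev q f = g.
  by apply: ev_inj => z Oz; rewrite mulopP// hg.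
move: gc; rewrite !rnormE lecE => /andP[_]; rewrite -/(cre (c * _)) mulrC cre_r2cM.
by rewrite mulrC.
Qed.

Definition var_sub w j (f : H) : H := mulop Omega ev (poly_var R j) f - w 0 j *: f.

Lemma ev_var_sub w j f z : Omega z ->
  ev (var_sub w j f) z = (z 0 j - w 0 j) * ev f z.
Proof.
by move=> Oz; rewrite evB// mulopP// evZ// peval_var mulrBl.
Qed.

Lemma var_subP w j (a : Cplx R) f g :
  var_sub w j (a *: f + g) = a *: var_sub w j f + var_sub w j g.
Proof.
by apply: ev_inj => z Oz; rewrite evP// !ev_var_sub// evP// mulrDr mulrCA.
Qed.

Lemma var_sub_bound w j : exists2 c : R, 0 <= c & forall f, rnorm (var_sub w j f) <= c * rnorm f.
Proof.
have [c hc] := mulop_bound (poly_var R j).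
exists (`|c| + rnorm (w 0 j)); first by rewrite addr_ge0// cre_norm_ge0.
move=> f; rewrite mulrDl (le_trans (rnormD _ _))// lerD//.
  by rewrite (le_trans (hc f))// ler_wpM2r ?rnorm_ge0// ler_norm.
by rewrite rnormN rnormZ.
Qed.

Lemma lin_closed_polys (I : set (Cpoly R m)) : I 0 ->
  (forall a q q', I q -> I q' -> I (mpoly.mpolyC m a * q + q')) ->
  lin_closed (polys_in Omega ev I).
Proof.
move=> I0 ID; split; first by exists 0 => // z Oz; rewrite ev0// peval0.
move=> a u v [q Iq hq] [q' Iq' hq']; exists (mpoly.mpolyC m a * q + q').
  exact: ID.
by move=> z Oz; rewrite evP// hq// hq'// pevalD pevalM pevalC.
Qed.

Lemma poly_vec q : exists f, represents Omega ev f (peval q).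
Proof. exact: (ahm_poly AHM). Qed.

(** The maximal ideal of w is generated by the z_j - w_j. *)
Lemma poly_factor q w : exists c : 'I_m -> Cpoly R m,
  q = mpoly.mpolyC m (peval q w) +
      \sum_j (poly_var R j - mpoly.mpolyC m (w 0 j)) * c j.
Proof.
elim/Cpoly_ind: q => [c|j|p q [c hc] [d hd]|p q [c hc] [d hd]].
- exists (fun=> 0); rewrite pevalC big1 ?addr0// => j _; by rewrite mulr0.
- exists (fun i => (i == j)%:R); rewrite peval_var (bigD1 j)//= eqxx mulr1.
  rewrite big1 ?addr0 => [|i /negbTE ->]; last by rewrite mulr0.
  by rewrite addrC subrK.
- exists (fun j => c j + d j); rewrite {1}hc {1}hd pevalD mpoly.mpolyCD.
  by rewrite addrACA -big_split; congr (_ + _); apply: eq_bigr => j _; rewrite mulrDr.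
- exists (fun j => c j * q + mpoly.mpolyC m (peval p w) * d j).
  rewrite pevalM mpoly.mpolyCM.
  under eq_bigr do rewrite mulrDr mulrA mulrCA.
  rewrite big_split /= -mulr_suml -mulr_sumr.
  set P := mpoly.mpolyC m (peval p w); set Q := mpoly.mpolyC m (peval q w).
  transitivity ((P + \sum_j (poly_var R j - mpoly.mpolyC m (w 0 j)) * c j) * q).
    by rewrite -hc.
  rewrite mulrDl {1}hd -/Q; ring.
Qed.

Section Ideal.
Variables (t : nat) (p : 'I_t -> Cpoly R m) (w : Cspace R m).
Let I := ideal_gen p.
Let S := polys_in Omega ev I.
Let M := closure S.

(** The product of I with the maximal ideal of w. *)
Definition max_ideal_mul : set (Cpoly R m) :=
  [set q | exists2 c : 'I_t -> Cpoly R m, forall i, peval (c i) w = 0 &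
    q = \sum_(i < t) c i * p i].
Let D := polys_in Omega ev max_ideal_mul.

Lemma lin_closed_ideal : lin_closed S.
Proof.
apply: lin_closed_polys => [|a q q' [c ->] [c' ->]].
  by exists (fun=> 0); rewrite big1// => i _; rewrite mul0r.
exists (fun i => mpoly.mpolyC m a * c i + c' i).
by rewrite mulr_sumr -big_split; apply: eq_bigr => i _; rewrite mulrDl mulrA.
Qed.

Lemma var_sub_ideal j f : S f -> D (var_sub w j f).
Proof.
move=> [_ [c ->] hf]; set xj := poly_var R j - mpoly.mpolyC m (w 0 j).
exists (\sum_i (xj * c i) * p i).
  exists (fun i => xj * c i) => // i.
  by rewrite pevalM pevalB peval_var pevalC subrr mul0r.
move=> z Oz; rewrite ev_var_sub// hf// !peval_sum mulr_sumr; apply: eq_bigr => i _.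
by rewrite !pevalM pevalB peval_var pevalC mulrA.
Qed.

Lemma max_ideal_mul_var_sub f : D f -> exists2 F : 'I_m -> H,
  forall j, S (F j) & f = \sum_j var_sub w j (F j).
Proof.
move=> [_ [c cw ->] hf].
have [d hd] := choice (fun i => poly_factor (c i) w).
have [F hF] := choice (fun j => poly_vec (\sum_i d i j * p i)).
exists F => [j|].
  by exists (\sum_i d i j * p i) => //; exists (fun i => d i j).
apply: ev_inj => z Oz; rewrite ev_sum// hf// peval_sum.
under [RHS]eq_bigr => j _ do rewrite ev_var_sub// hF// peval_sum mulr_sumr.
rewrite exchange_big /=; apply: eq_bigr => i _.
rewrite pevalM {1}hd cw mpoly.mpolyC0 add0r peval_sum mulr_suml.
by apply: eq_bigr => j _; rewrite !pevalM pevalB peval_var pevalC mulrA.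
Qed.

Lemma var_sub_closure j f : M f -> closure D (var_sub w j f).
Proof.
move=> /closure_rnormP cf; apply/closure_rnormP => e e0.
have [c c0 hc] := var_sub_bound w j.
have c1 : 0 < c + 1 by rewrite ltr_wpDl.
have [s Ss fs] := cf _ (divr_gt0 e0 c1).
exists (var_sub w j s); first exact: var_sub_ideal.
have -> : var_sub w j f - var_sub w j s = var_sub w j (f - s).
  by rewrite addrC -scaleN1r -var_subP scaleN1r addrC.
apply: le_lt_trans (hc _) _.
apply: le_lt_trans (_ : _ <= (c + 1) * rnorm (f - s)) _.
  by rewrite ler_wpM2r ?rnorm_ge0// lerDl.
by rewrite mulrC -ltr_pdivlMr.
Qed.

Lemma lin_closed_M : lin_closed M.
Proof. exact: lin_closed_closure lin_closed_ideal. Qed.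

(** The Riesz theorem provides the vector that the adjoint chooses. *)
Lemma adjoint_in0 j g : M g ->
  adjoint_in dot M (var_sub w j) g = 0 <-> forall f, M f -> dot (var_sub w j f) g = 0.
Proof.
move=> Mg; have [c c0 hc] := var_sub_bound w j.
have [a u v Mu Mv|u Mu|h Mh hE] := @riesz R H dot dot_norm M
   (fun f => dot (var_sub w j f) g) (c * rnorm g) (@closed_closure _ _) lin_closed_M.
- by rewrite var_subP dotDl dotZl.
- rewrite (le_trans (cauchy_schwarz dot_norm _ _))// mulrAC ler_wpM2r ?rnorm_ge0//.
rewrite /adjoint_in; case: xgetP => [h' _ [Mh' hE']|/(_ h)]; last by case.
split => [h0 f Mf|h0]; first by rewrite hE'// h0 dot0r.
have : dot h' h' = 0 by rewrite -hE'// h0.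
by move/eqP; rewrite -dot_norm expf_eq0 /= normr_eq0 => /eqP.
Qed.

(** Products of I with the maximal ideal are sums of multiples of the
    z_j - w_j by elements of I; conversely orthogonality passes from I to its
    closure by continuity of the multiplications. *)
Lemma joint_kernelE : joint_kernel Omega dot ev M w =
  [set g | M g /\ forall d, D d -> dot d g = 0].
Proof.
apply/seteqP; split => g [Mg hg]; split=> //.
  move=> d /max_ideal_mul_var_sub[F SF ->]; rewrite linear_sumlz big1// => j _.
  by apply: ((adjoint_in0 j Mg).1 (hg j)); exact: subset_closure.
move=> j; apply/(adjoint_in0 j Mg) => f Mf.
apply: (orth_closure dot_norm hg); exact: var_sub_closure.
Qed.

End Ideal.
End Module.

(** * The dimension of the joint kernel *)

Section Minimality.
Variables (R : realType) (m : nat) (Omega : set (Cspace R m)).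
Variables (H : completeNormedModType (Cplx R)) (dot : {dot H for @Num.conj (Cplx R)}).
Variable ev : H -> Cspace R m -> Cplx R.
Hypothesis AHM : analytic_hilbert_module Omega dot ev.
Variables (t : nat) (p : 'I_t -> Cpoly R m).
Let I := ideal_gen p.
Let V := zero_set I `&` Omega.
Variables (w : Cspace R m).
Hypotheses (subV : complex_submanifold Omega V t) (Vw : V w).

(** The sum of the product of I with the maximal ideal of w and of the ideal
    generated by the p_j with j <> i. *)
Definition coef_vanishing (i : 'I_t) : set (Cpoly R m) :=
  [set q | exists2 c : 'I_t -> Cpoly R m, peval (c i) w = 0 &
    q = \sum_j c j * p j].

Lemma gen_ideal i : I (p i).
Proof.
exists (fun j => (j == i)%:R); rewrite (bigD1 i)//= eqxx mul1r big1 ?addr0//.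
by move=> j /negbTE ->; rewrite mul0r.
Qed.

Lemma lin_closed_coef_vanishing i :
  lin_closed (polys_in Omega ev (coef_vanishing i)).
Proof.
apply: (lin_closed_polys AHM).
  by exists (fun=> 0); [exact: peval0|rewrite big1// => j _; rewrite mul0r].
move=> a _ _ [c cw ->] [c' cw' ->].
exists (fun i => mpoly.mpolyC m a * c i + c' i).
  by rewrite pevalD pevalM cw cw' mulr0 addr0.
by rewrite mulr_sumr -big_split; apply: eq_bigr => j _; rewrite mulrDl mulrA.
Qed.

(** On the curve Z where the p_j with j <> i and the equations l_j of a slice
    vanish, an element of coef_vanishing i is a multiple a p_i with a(w) = 0.
    If it were close to p_i in norm, a - 1 would be small on the points of Z
    of a sphere, against the maximum principle. *)
Lemma generator_notin_closure i f : represents Omega ev f (peval (p i)) ->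
  ~ closure (polys_in Omega ev (coef_vanishing i)) f.
Proof.
move=> hf /closure_rnormP cf.
have [tm [l [r [r0 lw rO rV]]]] := submanifold_slice subV Vw.
pose i0 : 'I_m := widen_ord tm i.
pose G (j : 'I_m) : Cpoly R m := if insub (val j) is Some k then p k else l j.
have GE (k : 'I_t) : G (widen_ord tm k) = p k.
  rewrite /G /=; case: insubP => [k' _ kk'|]; last by rewrite ltn_ord.
  by congr p; apply: val_inj.
have Gl (j : 'I_m) : (t <= j)%N -> G j = l j.
  by move=> tj; rewrite /G insubF//= ltnNge tj.
have Vp k : peval (p k) w = 0 by apply: Vw.1; exact: gen_ideal.
have Gw j : j != i0 -> peval (G j) w = 0.
  by move=> _; rewrite /G; case: insub.
pose K := [set z | `|z - w| = r2c r /\ forall j, j != i0 -> peval (G j) z = 0].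
have KO z : K z -> rnorm (z - w) <= r by move=> [zr _]; rewrite -rnorm_le zr.
have Kp z (c : 'I_t -> Cpoly R m) : K z ->
    peval (\sum_j c j * p j) z = peval (c i) z * peval (p i) z.
  move=> [_ Gz]; rewrite peval_sum (bigD1 i)//= pevalM big1 ?addr0// => j ji.
  by rewrite pevalM -(GE j) Gz ?mulr0.
have Kpi z : K z -> peval (p i) z != 0.
  move=> Kz; apply/eqP => pz.
  have zw : z = w.
    apply: rV; [exact: KO| |].
      by split; [move=> _ [c ->]; rewrite Kp// pz mulr0|exact/rO/KO].
    move=> j tj; rewrite -Gl//; apply: Kz.2.
    by apply: contraTneq tj => ->; rewrite -ltnNge /= ltn_ord.
  case: Kz => + _; rewrite zw subrr normr0 => /(congr1 (@cre R)) /esym /eqP.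
  by rewrite gt_eqF.
(* K is not empty, which allows minimising |p_i| over it. *)
have [z1 [z1r z1G _]] := max_principle_curve 1 r0 Gw.
have cK : compact K.
  apply: subclosed_compact (@compact_cball R m w r) _ => [|z /KO]; last first.
    by rewrite /= rnorm_le.
  rewrite (_ : K = (fun z => rnorm (z - w)) @^-1` [set x | x = r] `&`
      \bigcap_(j in [set j | j != i0])
        (fun z => sqmod (peval (G j) z)) @^-1` [set x | x = 0]).
    apply: closedI; first last.
      apply: closed_bigI => j _; apply: preimage_closed; last exact: closed_eq.
      move=> z _; apply: (continuous_comp (@peval_continuous _ _ _ _)).
      exact: sqmod_continuous.
    apply: preimage_closed; last exact: closed_eq.
    by move=> z _; exact: cnormB_continuous.
  apply/seteqP; split => z [] /= zr zG; split.
  - by rewrite /rnorm zr.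
  - by move=> j /= /zG ->; rewrite sqmod0.
  - by rewrite rnormE zr.
  - by move=> j /zG /eqP; rewrite sqmod_eq0 => /eqP.
have pc : {within K, continuous (fun z => rnorm (peval (p i) z))}.
  apply: continuous_subspaceT => z; apply: (continuous_comp (@peval_continuous _ _ _ _)).
  have := @cnormB_continuous R _ (0 : (Cplx R)^o) (peval (p i) z).
  by under eq_fun do rewrite subr0.
have [z0 + zmin] := compact_EVT_min (ex_intro _ z1 (conj z1r z1G)) cK pc.
rewrite inE => Kz0.
have d0 : 0 < rnorm (peval (p i) z0).
  rewrite lt_neqAle rnorm_ge0 andbT eq_sym; apply/eqP => /rnorm_eq0 /eqP.
  by rewrite (negbTE (Kpi _ Kz0)).
set d := rnorm _ in d0 zmin.
have [C C0 hC] := ev_bounded_on_ball AHM rO.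
have C1 : 0 < C + 1 by rewrite ltr_wpDl.
have [g [q [c cw ->] hg] fg] := cf _ (divr_gt0 d0 C1).
have [z [zr zG zh]] := max_principle_curve (c i - 1) r0 Gw.
have Kz : K z by [].
have zO := KO z Kz; have Oz := rO z zO.
have dz : d <= rnorm (peval (p i) z) by apply: zmin; rewrite inE.
move: zh; rewrite pevalB peval1 cw sub0r normrN normr1 => zh.
have : rnorm (ev (g - f) z) <= C * rnorm (g - f) by exact: hC.
rewrite (evB AHM)// hg// hf// Kp// -[X in _ - X]mul1r -mulrBl rnormM.
rewrite pevalB peval1 in zh.
apply/negP; rewrite -ltNge.
apply: (@lt_le_trans _ _ d); last first.
  rewrite -[d]mul1r ler_pM ?(ltW d0)//.
  by rewrite -(r2c_le 1) -rnormE.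
rewrite rnormC; apply: (@le_lt_trans _ _ ((C + 1) * rnorm (f - g))).
  by rewrite ler_wpM2r ?rnorm_ge0// lerDl.
by rewrite mulrC -ltr_pdivlMr.
Qed.

(** Modulo the product with the maximal ideal, I is spanned by the p_i with
    constant coefficients. *)
Lemma joint_kernel_dim_on_zeros :
  has_dim (joint_kernel Omega dot ev (closure (polys_in Omega ev I)) w) t.
Proof.
have dot_norm := ahm_norm AHM.
have lS : lin_closed (polys_in Omega ev I) := lin_closed_ideal AHM p.
rewrite (joint_kernelE AHM p w).
have [f hf] := choice (fun i => poly_vec AHM (p i)).
apply: (@orth_dim R H dot dot_norm _ _ t f
  (fun i => polys_in Omega ev (coef_vanishing i))) => //.
- by move=> i; exact: lin_closed_coef_vanishing.
- by move=> i g [_ [c _ ->] hg]; exists (\sum_j c j * p j) => //; exists c.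
- by move=> i; exists (p i) => //; exact: gen_ideal.
- by move=> i g [q [c cw ->] hg]; exists (\sum_j c j * p j) => //; exists c.
- move=> i j ji; exists (p j) => //; exists (fun k => (k == j)%:R).
    by rewrite eq_sym (negbTE ji) peval0.
  rewrite (bigD1 j)//= eqxx mul1r big1 ?addr0// => k /negbTE ->.
  by rewrite mul0r.
- by move=> i; apply: generator_notin_closure; exact: hf.
- move=> s [_ [a ->] hs]; exists (fun i => peval (a i) w).
  exists (s - \sum_i peval (a i) w *: f i); last by rewrite addrC subrK.
  exists (\sum_i (a i - mpoly.mpolyC m (peval (a i) w)) * p i).
    exists (fun i => a i - mpoly.mpolyC m (peval (a i) w)) => // i.
    by rewrite pevalB pevalC subrr.
  move=> z Oz; rewrite (evB AHM)// (ev_sum AHM)// hs// !peval_sum.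
  rewrite -sumrB; apply: eq_bigr => i _.
  by rewrite (evZ AHM)// hf// !pevalM pevalB pevalC mulrBl.
Qed.

End Minimality.

(** Modulo the product with the maximal ideal, f in I equals f(w) q0. *)
Lemma joint_kernel_dim_off_zeros (R : realType) (m : nat)
    (Omega : set (Cspace R m)) (H : completeNormedModType (Cplx R))
    (dot : {dot H for @Num.conj (Cplx R)}) (ev : H -> Cspace R m -> Cplx R)
    (t : nat) (p : 'I_t -> Cpoly R m) (w : Cspace R m) :
  analytic_hilbert_module Omega dot ev -> Omega w ->
  ~ zero_set (ideal_gen p) w ->
  has_dim
    (joint_kernel Omega dot ev (closure (polys_in Omega ev (ideal_gen p))) w) 1.
Proof.
move=> AHM Ow nVw; have dot_norm := ahm_norm AHM.
set I := ideal_gen p in nVw *.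
have lS : lin_closed (polys_in Omega ev I) := lin_closed_ideal AHM p.
rewrite (joint_kernelE AHM p w).
have [q0 Iq0 q0w] : exists2 q, I q & peval q w = 1.
  move: nVw => /existsNP[q /not_implyP[[c ->] /eqP qw]].
  exists (mpoly.mpolyC m (peval (\sum_i c i * p i) w)^-1 * \sum_i c i * p i).
    exists (fun i => mpoly.mpolyC m (peval (\sum_i c i * p i) w)^-1 * c i).
    by rewrite mulr_sumr; apply: eq_bigr => i _; rewrite mulrA.
  by rewrite pevalM pevalC mulVf.
have [f0 hf0] := poly_vec AHM q0.
pose N : set (Cpoly R m) := [set q | I q /\ peval q w = 0].
apply: (@orth_dim R H dot dot_norm _ _ 1 (fun=> f0) (fun=> polys_in Omega ev N)) => //.
- move=> _; apply: (lin_closed_polys AHM).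
    split; last exact: peval0.
    by exists (fun=> 0); rewrite big1// => i _; rewrite mul0r.
  move=> a _ _ [[c ->] cw] [[c' ->] cw']; split; last first.
    by rewrite pevalD pevalM cw cw' mulr0 addr0.
  exists (fun i => mpoly.mpolyC m a * c i + c' i).
  by rewrite mulr_sumr -big_split; apply: eq_bigr => i _; rewrite mulrDl mulrA.
- by move=> _ f [q [Iq _] hq]; exists q.
- by move=> _; exists q0.
- move=> _ f [_ [c cw ->] hf]; exists (\sum_i c i * p i) => //; split; first by exists c.
  by rewrite peval_sum big1// => i _; rewrite pevalM cw mul0r.
- by move=> i j; rewrite (ord1 i) (ord1 j).
- move=> _ f0N; have [k hk] := ev_dot AHM Ow.
  have /eqP : ev f0 w = 0.
    rewrite hk; apply: (orth_closure dot_norm _ f0N) => s [q [_ qw] hq].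
    by rewrite -hk hq.
  by rewrite hf0// q0w oner_eq0.
- move=> s [q [a qa] hs]; exists (fun=> peval q w).
  exists (s - peval q w *: f0); last by rewrite big_ord1 addrC subrK.
  have [b q0b] := Iq0.
  exists (q - mpoly.mpolyC m (peval q w) * q0).
    exists (fun i => (1 - q0) * a i + (q - mpoly.mpolyC m (peval q w)) * b i).
      move=> i; rewrite pevalD !pevalM !pevalB peval1 q0w pevalC !subrr.
      by rewrite !mul0r addr0.
    under eq_bigr do rewrite mulrDl -!mulrA.
    rewrite big_split /= -!mulr_sumr -qa -q0b; ring.
  by move=> z Oz; rewrite (evB AHM)// (evZ AHM)// hs// hf0// pevalB pevalM pevalC.
Qed.

Theorem corollary4p4 (R : realType) (m : nat) (Omega : set (Cspace R m))
    (H : completeNormedModType (Cplx R)) (dot : {dot H for @Num.conj (Cplx R)})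
    (ev : H -> Cspace R m -> Cplx R) (t : nat) (p : 'I_t -> Cpoly R m) :
  domain Omega -> bounded_set Omega ->
  analytic_hilbert_module Omega dot ev ->
  let I := ideal_gen p in
  let M := closure (polys_in Omega ev I) in
  let V := zero_set I `&` Omega in
  complex_submanifold Omega V t ->
  forall w, Omega w ->
    (~ V w -> has_dim (joint_kernel Omega dot ev M w) 1) /\
    (V w -> has_dim (joint_kernel Omega dot ev M w) t).
Proof.
move=> _ _ AHM I M V subV w Ow; split => [nVw|Vw].
  by apply: joint_kernel_dim_off_zeros => // Iw; apply: nVw.
exact: (joint_kernel_dim_on_zeros AHM subV Vw).
Qed.
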